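(* Let $\Lambda$ be a finite dimensional eventually periodic algebra over a field $k$. Then $\Lambda$ is a Gorenstein algebra if and only if the Gorenstein dimension $\operatorname{G\text{-}dim}_{\Lambda^{\mathrm e}}\Lambda$ of the regular $\Lambda$-bimodule $\Lambda$ is finite. In this case, $\operatorname{G\text{-}dim}_{\Lambda^{\mathrm e}} \Lambda= \operatorname{inj.dim}_{\Lambda}\Lambda$.
   Context: Rings are associative and unital; modules are left modules. $\Lambda^{\mathrm e}=\Lambda\otimes_k\Lambda^{\mathrm{op}}$; $\Lambda^{\mathrm e}$-modules are identified with $\Lambda$-bimodules on which $k$ acts centrally. For a finite dimensional algebra $A$ and an $A$-module $M$, the syzygy $\Omega_A(M)$ is the kernel of a projective cover of $M$, $\Omega_A^0(M)=M$ and $\Omega_A^n(M)=\Omega_A(\Omega_A^{n-1}(M))$. $M$ is periodic if $\Omega_A^p(M)\cong M$ as $A$-modules for some $p>0$, and eventually periodic if $\Omega_A^n(M)$ is periodic for some $n\ge 0$. The algebra $\Lambda$ is eventually periodic if the regular bimodule $\Lambda$ is eventually periodic as a $\Lambda^{\mathrm e}$-module. $\Lambda$ is Gorenstein if it has finite injective dimension as a left and as a right module over itself. For a (two-sided) Noetherian ring $R$, a finitely generated $R$-module $X$ is totally reflexive if the canonical map $X\to X^{**}$ is an isomorphism (where $(-)^*$ denotes $\operatorname{Hom}(-,R)$) and $\operatorname{Ext}^i_R(X,R)=0=\operatorname{Ext}^i_{R^{\mathrm{op}}}(X^*,R)$ for all $i>0$. The Gorenstein dimension $\operatorname{G\text{-}dim}_R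 M$ of a finitely generated $R$-module $M$ is the infimum of the lengths $n$ of exact sequences $0\to X_n\to\cdots\to X_0\to M\to 0$ with each $X_i$ finitely generated and totally reflexive. *)

(* Defs.v *)
From HB Require Import structures.
From mathcomp Require Import all_boot all_order all_algebra all_field.
From mathcomp Require Import boolp functions.

Set Implicit Arguments.
Unset Strict Implicit.
Unset Printing Implicit Defensive.

Import GRing.Theory.
Local Open Scope ring_scope.

(* Conventions: the left modules over a ring R are the objects of [lmodType R];
   the right modules are the left modules over the converse ring [R^c].
   Values in the extended natural numbers have type [option nat], with [None]
   for infinity. *)

Definition inf_nat (S : nat -> Prop) : option nat :=
  match pselect (exists n, `[<S n>]) with
  | left ex => Some (ex_minn ex)
  | right _ => None
  end.

Lemma inf_natP (S : nat -> Prop) n :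
  inf_nat S = Some n <-> S n /\ (forall m, S m -> (n <= m)%N).
Proof.
rewrite /inf_nat; case: pselect => [ex|nex]; last first.
  by split=> // -[Sn _]; case: nex; exists n; apply/asboolP.
case: ex_minnP => m Sm' min_m; have Sm : S m by apply/asboolP.
split=> [[<-]|[Sn min_n]].
  by split=> // p Sp; apply/min_m/asboolP.
congr Some; apply/eqP; rewrite eqn_leq min_n // andbT.
by apply/min_m/asboolP.
Qed.

Lemma inf_nat_None (S : nat -> Prop) :
  inf_nat S = None <-> forall n, ~ S n.
Proof.
rewrite /inf_nat; case: pselect => [ex|nex]; split=> //.
  by case: ex => n Sn nS; case: (nS n); apply/asboolP.
by move=> _ n Sn; case: nex; exists n; apply/asboolP.
Qed.

Section Modules.
Variable R : pzRingType.
Implicit Types M N P K L X : lmodType R.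

Definition module_iso M N : Prop := exists f : {linear M -> N}, bijective f.

Definition onto (S T : Type) (f : S -> T) : Prop := forall y, exists x, f x = y.

Definition exact_at (S T : Type) (U : zmodType) (f : S -> T) (g : T -> U) :=
  forall y, g y = 0 <-> exists x, f x = y.

Definition trivial_module M : Prop := forall x : M, x = 0.

Definition fin_gen M : Prop :=
  exists (n : nat) (g : 'I_n -> M),
    forall x, exists c : 'I_n -> R, x = \sum_i c i *: g i.

Definition projective_module P : Prop :=
  forall M N (f : {linear M -> N}) (g : {linear P -> N}), onto f ->
    exists h : {linear P -> M}, forall x, f (h x) = g x.

Definition injective_module P : Prop :=
  forall M N (f : {linear M -> N}) (g : {linear M -> P}), injective f ->
    exists h : {linear N -> P}, forall x, h (f x) = g x.

Definition superfluous P (K : P -> Prop) : Prop :=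
  forall S : {pred P}, submod_closed S ->
    (forall x, exists s t, [/\ s \in S, K t & x = s + t]) ->
    forall x, x \in S.

Definition projective_cover P M (p : {linear P -> M}) : Prop :=
  [/\ projective_module P, onto p & superfluous (fun x => p x = 0)].

(* [is_syzygy n M K] reads "K is isomorphic to the n-th syzygy of M"; syzygies
   are only defined up to isomorphism, since projective covers are. *)
Definition is_syzygy1 M K : Prop :=
  exists P (p : {linear P -> M}) (i : {linear K -> P}),
    [/\ projective_cover p, injective i & exact_at i p].

Fixpoint is_syzygy (n : nat) M K : Prop :=
  match n with
  | 0 => module_iso M K
  | m.+1 => exists L, is_syzygy m M L /\ is_syzygy1 L K
  end.

Definition periodic M : Prop := exists p : nat, (0 < p)%N /\ is_syzygy p M M.

Definition eventually_periodic M : Prop :=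
  exists (n : nat) K, is_syzygy n M K /\ periodic K.

Definition projective_resolution M (P : nat -> lmodType R)
    (d : forall i, {linear P i.+1 -> P i}) (e : {linear P 0 -> M}) : Prop :=
  [/\ forall i, projective_module (P i), onto e, exact_at (d 0) e
    & forall i, exact_at (d i.+1) (d i)].

Section Cochains.
Variables (P : nat -> lmodType R) (d : forall i, {linear P i.+1 -> P i}).
Variable N : lmodType R.

Definition cocycle i (f : {linear P i -> N}) : Prop :=
  forall x, f (d i x) = 0.

Definition coboundary i : {linear P i -> N} -> Prop :=
  match i with
  | 0 => fun f => forall x, f x = 0
  | j.+1 => fun f => exists g : {linear P j -> N}, forall x, f x = g (d j x)
  end.
End Cochains.

(* Ext^i_R(M, N) = 0, i.e. the i-th cohomology of Hom_R(P, N) vanishes, where P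
   is a projective resolution of M (which one is immaterial). *)
Definition Ext_vanishes (i : nat) M N : Prop :=
  exists (P : nat -> lmodType R) (d : forall i, {linear P i.+1 -> P i})
         (e : {linear P 0 -> M}),
    projective_resolution d e /\
    forall f : {linear P i -> N}, cocycle d f -> coboundary d f.

(* Exact sequences 0 -> M -> I 0 -> ... -> I n -> 0 with injective terms,
   extended by trivial modules to all degrees. *)
Definition has_injective_resolution M (n : nat) : Prop :=
  exists (I : nat -> lmodType R) (e : {linear M -> I 0})
         (d : forall i, {linear I i -> I i.+1}),
    [/\ injective e, exact_at e (d 0), forall i, exact_at (d i) (d i.+1),
        forall i, (i <= n)%N -> injective_module (I i)
      & forall i, (n < i)%N -> trivial_module (I i)].

Definition inj_dim M : option nat := inf_nat (has_injective_resolution M).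

End Modules.

(* The dual X^* = Hom_R(X, R) as a module over R^c, (f a)(x) = f(x) a: this is
   the action that the functions X -> (R^c)^o inherit pointwise. *)
Definition hom_pred (R : pzRingType) (X : lmodType R) : {pred X -> (R^c)^o} :=
  fun f => `[<linear (f : X -> R^o)>].
Arguments hom_pred {R} X _.

Section Dual.
Variables (R : pzRingType) (X : lmodType R).

Lemma hom_pred_submod : submod_closed (hom_pred X).
Proof.
split=> [|a f g /asboolP lf /asboolP lg]; apply/asboolP => b x y /=.
  by rewrite /GRing.zero /= /GRing.scale /= mulr0 addr0.
rewrite /GRing.add /= /GRing.scale /=.
rewrite (lf b x y) (lg b x y) /GRing.scale /= {1 3 5}/GRing.mul /=.
by rewrite mulrDl mulrDr addrACA mulrA.
Qed.

HB.instance Definition _ :=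
  GRing.isSubmodClosed.Build _ _ (hom_pred X) hom_pred_submod.

Record dual := Dual { dual_fun : X -> (R^c)^o; dualP : dual_fun \in hom_pred X }.

HB.instance Definition _ := [isSub for dual_fun].
HB.instance Definition _ := [Choice of dual by <:].
HB.instance Definition _ := [SubChoice_isSubLmodule of dual by <:].

Lemma dual_funE (f : dual) : dual_fun f = val f.
Proof. by []. Qed.

Lemma dual_scaleE (a : R) (f : dual) x :
  dual_fun ((a : R^c) *: f) x = (dual_fun f x : R) * a :> R.
Proof. by rewrite !dual_funE linearZ_LR. Qed.

Lemma dual_addE (f g : dual) x :
  dual_fun (f + g) x = dual_fun f x + dual_fun g x.
Proof. by rewrite !dual_funE raddfD. Qed.

End Dual.

Section TotallyReflexive.
Variable R : pzRingType.

Lemma bidual_subproof (X : lmodType R) (x : X) :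
  (fun f : dual X => dual_fun f x) \in hom_pred (dual X).
Proof.
apply/asboolP => a f g.
by rewrite dual_addE (dual_scaleE (a : R)).
Qed.

(* The canonical map X -> X^**. The bidual is a module over R^c^c, which is R
   only up to a change of the proof components; this is why the isomorphism
   condition below is stated as bijectivity. *)
Definition bidual (X : lmodType R) (x : X) : dual (dual X) :=
  Dual (bidual_subproof x).

Definition totally_reflexive (X : lmodType R) : Prop :=
  [/\ fin_gen X, bijective (@bidual X),
      forall i : nat, (0 < i)%N -> Ext_vanishes i X R^o
    & forall i : nat, (0 < i)%N -> Ext_vanishes i (dual X) (R^c)^o].

(* Exact sequences 0 -> X n -> ... -> X 0 -> M -> 0 with totally reflexive
   terms, extended by trivial modules to all degrees. *)
Definition has_Gresolution (M : lmodType R) (n : nat) : Prop :=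
  exists (X : nat -> lmodType R) (e : {linear X 0 -> M})
         (d : forall i, {linear X i.+1 -> X i}),
    [/\ onto e, exact_at (d 0) e, forall i, exact_at (d i.+1) (d i),
        forall i, (i <= n)%N -> totally_reflexive (X i)
      & forall i, (n < i)%N -> trivial_module (X i)].

Definition Gdim (M : lmodType R) : option nat := inf_nat (has_Gresolution M).

End TotallyReflexive.

Lemma linear_comb (k : pzRingType) (U V : lmodType k) (f : U -> V) (I : Type)
    (r : seq I) (c : I -> k) (u : I -> U) : linear f ->
  f (\sum_(i <- r) c i *: u i) = \sum_(i <- r) c i *: f (u i).
Proof.
move=> fl; elim: r => [|i r IHr]; last by rewrite !big_cons fl IHr.
by rewrite !big_nil; have := fl (-1) 0 0; rewrite scaler0 add0r scaleN1r addNr.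
Qed.

(* The tensor product A (x)_k A as the space of square matrices over k: the
   (i, j) entry is the coordinate on e_i (x) e_j, for the basis (e_i) chosen by
   [vbasis]. The product makes it the enveloping algebra A (x)_k A^op. *)
Definition envelope (k : fieldType) (A : falgType k) : Type :=
  'M[k]_(\dim {:A}, \dim {:A}).

Section Envelope.
Variables (k : fieldType) (A : falgType k).
Local Notation n := (\dim {:A}).
Local Notation crd := (coord (vbasis {:A})).

HB.instance Definition _ := GRing.Lmodule.on (envelope A).

Definition vbase (i : 'I_n) : A := (vbasis {:A})`_i.

Definition tens (a b : A) : envelope A := \matrix_(i, j) (crd i a * crd j b).

Definition bilin_ext (V : lmodType k) (f : A -> A -> V) (M : envelope A) : V :=
  \sum_i \sum_j M i j *: f (vbase i) (vbase j).

Definition env_one : envelope A := tens 1 1.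

(* (a (x) b) (c (x) d) = a c (x) d b *)
Definition env_mul (M N : envelope A) : envelope A :=
  bilin_ext (fun a b => bilin_ext (fun c d => tens (a * c) (d * b)) N) M.

Definition bilinear_map (V : lmodType k) (f : A -> A -> V) : Prop :=
  (forall b, linear (f^~ b)) /\ (forall a, linear (f a)).

Lemma tens_bilinear : bilinear_map tens.
Proof.
split=> [b c x y|a c x y]; apply/matrixP => i j; rewrite !mxE linearP /=.
  by rewrite mulrDl mulrA.
by rewrite mulrDr mulrCA.
Qed.

Lemma vbase_sum (a : A) : a = \sum_i crd i a *: vbase i.
Proof. exact: coord_vbasis (memvf a). Qed.

Section Ext.
Variables (V : lmodType k) (f : A -> A -> V).

Lemma bilin_ext_linear : linear (bilin_ext f).
Proof.
move=> c M N; rewrite /bilin_ext scaler_sumr -big_split /=.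
apply: eq_bigr => i _; rewrite scaler_sumr -big_split /=.
by apply: eq_bigr => j _; rewrite !mxE scalerDl scalerA.
Qed.

Lemma bilin_ext_tens : bilinear_map f ->
  forall a b, bilin_ext f (tens a b) = f a b.
Proof.
case=> fl fr a b.
rewrite [in RHS](vbase_sum a) (linear_comb _ _ _ (fl b)) /=.
apply: eq_bigr => i _.
rewrite [in RHS](vbase_sum b) (linear_comb _ _ _ (fr (vbase i))) scaler_sumr.
apply: eq_bigr => j _; rewrite scalerA.
by rewrite mxE.
Qed.

End Ext.

Lemma bilin_ext_comb (V : lmodType k) c (f g : A -> A -> V) M :
  bilin_ext (fun a b => c *: f a b + g a b) M =
    c *: bilin_ext f M + bilin_ext g M.
Proof.
rewrite /bilin_ext scaler_sumr -big_split; apply: eq_bigr => i _ /=.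
rewrite scaler_sumr -big_split; apply: eq_bigr => j _ /=.
by rewrite scalerDr !scalerA [c * _]mulrC.
Qed.

Lemma tens_vbase i j : tens (vbase i) (vbase j) = delta_mx i j.
Proof.
have fr : free (vbasis {:A}) := basis_free (vbasisP _).
apply/matrixP => p q; rewrite !mxE !coord_free // -natrM mulnb.
by rewrite (eq_sym p) (eq_sym q).
Qed.

Lemma env_sum (M : envelope A) :
  M = \sum_i \sum_j M i j *: tens (vbase i) (vbase j).
Proof.
rewrite {1}[M]matrix_sum_delta.
by apply: eq_bigr => i _; apply: eq_bigr => j _; rewrite tens_vbase.
Qed.

Lemma env_ind (V : lmodType k) (f g : envelope A -> V) :
  linear f -> linear g -> (forall a b, f (tens a b) = g (tens a b)) -> f =1 g.
Proof.
move=> fl gl fg M.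
rewrite (env_sum M) pair_bigA /= !linear_comb //.
by apply: eq_bigr => -[i j] _; rewrite fg.
Qed.

(* The universal property of the tensor product. *)
Lemma tens_universal (V : lmodType k) (f : A -> A -> V) : bilinear_map f ->
  exists! g : envelope A -> V, linear g /\ forall a b, g (tens a b) = f a b.
Proof.
move=> bf; exists (bilin_ext f); split.
  by split; [exact: bilin_ext_linear | exact: bilin_ext_tens].
move=> g [gl gE]; apply/funext; apply: env_ind => //.
  exact: bilin_ext_linear.
by move=> a b; rewrite gE bilin_ext_tens.
Qed.

Lemma env_mul_linearl (N : envelope A) : linear (env_mul^~ N).
Proof. by move=> c M M'; exact: bilin_ext_linear. Qed.

Lemma env_mul_linearr (M : envelope A) : linear (env_mul M).
Proof.
move=> c N N'; rewrite /env_mul -bilin_ext_comb; congr bilin_ext.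
by apply/funext => a; apply/funext => b; rewrite bilin_ext_linear.
Qed.

Lemma env_mul_tens (a b c d : A) :
  env_mul (tens a b) (tens c d) = tens (a * c) (d * b).
Proof.
have [tl tr] := tens_bilinear.
have inner a' b' : bilin_ext (fun c d => tens (a' * c) (d * b')) (tens c d) =
    tens (a' * c) (d * b').
  rewrite bilin_ext_tens //; split=> [e x y z|e x y z] /=.
    by rewrite mulrDr -scalerAr tl.
  by rewrite mulrDl -scalerAl tr.
rewrite /env_mul bilin_ext_tens ?inner //; split=> [e x y z|e x y z] /=.
  by rewrite !inner mulrDl -scalerAl tl.
by rewrite !inner mulrDr -scalerAr tr.
Qed.

Lemma env_mulA : associative env_mul.
Proof.
move=> x y z; move: x; apply: env_ind => [||a b].
- exact: env_mul_linearl.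
- by move=> c M N; rewrite !(env_mul_linearl _ c).
move: y; apply: env_ind => [||c d].
- by move=> e M N; rewrite (env_mul_linearl _ e) env_mul_linearr.
- by move=> e M N; rewrite env_mul_linearr env_mul_linearl.
move: z; apply: env_ind => [||e g].
- by move=> h M N; rewrite !env_mul_linearr.
- exact: env_mul_linearr.
by rewrite !env_mul_tens !mulrA.
Qed.

Lemma env_mul1 : left_id env_one env_mul.
Proof.
apply: env_ind => [||a b]; [exact: env_mul_linearr | by [] |].
by rewrite env_mul_tens mul1r mulr1.
Qed.

Lemma env_1mul : right_id env_one env_mul.
Proof.
apply: env_ind => [||a b]; [exact: env_mul_linearl | by [] |].
by rewrite env_mul_tens mul1r mulr1.
Qed.

Lemma env_mulDl : left_distributive env_mul +%R.
Proof. by move=> x y z; have := env_mul_linearl z 1 x y; rewrite !scale1r. Qed.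

Lemma env_mulDr : right_distributive env_mul +%R.
Proof. by move=> x y z; have := env_mul_linearr x 1 y z; rewrite !scale1r. Qed.

HB.instance Definition _ := GRing.Zmodule_isPzRing.Build (envelope A)
  env_mulA env_mul1 env_1mul env_mulDl env_mulDr.

Lemma tensM (a b c d : A) : tens a b * tens c d = tens (a * c) (d * b).
Proof. exact: env_mul_tens. Qed.

End Envelope.

(* The regular bimodule: (a (x) b) x = a x b. *)
Definition regular_bimodule (k : fieldType) (A : falgType k) : Type := A.

Section RegularBimodule.
Variables (k : fieldType) (A : falgType k).

HB.instance Definition _ := GRing.Zmodule.on (regular_bimodule A).

Definition bimod_scale (M : envelope A) (x : regular_bimodule A) :
    regular_bimodule A :=
  bilin_ext (fun a b => a * (x : A) * b : A) M.

Lemma bimod_scale_linear x : linear (bimod_scale^~ x : envelope A -> A).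
Proof. exact: bilin_ext_linear. Qed.

Lemma bimod_scale_tens (a b x : A) : bimod_scale (tens a b) x = a * x * b.
Proof.
rewrite /bimod_scale bilin_ext_tens //; split=> [c d y z|c d y z] /=.
  by rewrite !mulrDl -!scalerAl.
by rewrite mulrDr -scalerAr.
Qed.

Lemma bimod_scaleDr : right_distributive bimod_scale +%R.
Proof.
move=> M x y; rewrite /bimod_scale /bilin_ext -big_split /=.
apply: eq_bigr => i _; rewrite -big_split; apply: eq_bigr => j _ /=.
by rewrite -scalerDr mulrDr mulrDl.
Qed.

Lemma bimod_scaleDl x : {morph bimod_scale^~ x : M N / M + N}.
Proof.
by move=> M N; have := bimod_scale_linear x 1 M N; rewrite !scale1r.
Qed.

Lemma bimod_scale1 : left_id 1 bimod_scale.
Proof. by move=> x; rewrite bimod_scale_tens mul1r mulr1. Qed.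

Lemma bimod_scale_scale (c : k) (M : envelope A) (x : A) :
  bimod_scale M (c *: x) = c *: (bimod_scale M x : A).
Proof.
rewrite /bimod_scale /bilin_ext scaler_sumr.
apply: eq_bigr => i _; rewrite scaler_sumr; apply: eq_bigr => j _.
by rewrite -scalerAr -scalerAl !scalerA mulrC.
Qed.

Lemma bimod_scaleA (M N : envelope A) x :
  bimod_scale M (bimod_scale N x) = bimod_scale (M * N) x.
Proof.
move: M; apply: (@env_ind _ _ A) => [||a b].
- exact: bimod_scale_linear.
- move=> c M M'; rewrite -bimod_scale_linear; congr bimod_scale.
  exact: env_mul_linearl.
move: N; apply: (@env_ind _ _ A) => [||c d].
- move=> e N N'; rewrite (bimod_scale_linear x e).
  apply: etrans (bimod_scaleDr _ _ _) _; congr (_ + _).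
  exact: bimod_scale_scale.
- move=> e N N'; rewrite -bimod_scale_linear; congr bimod_scale.
  exact: env_mul_linearr.
by rewrite tensM !bimod_scale_tens !mulrA.
Qed.

HB.instance Definition _ :=
  GRing.Zmodule_isLmodule.Build (envelope A) (regular_bimodule A)
    bimod_scaleA bimod_scale1 bimod_scaleDr bimod_scaleDl.

Lemma tens_scale (a b x : A) :
  tens a b *: (x : regular_bimodule A) = a * x * b.
Proof. exact: bimod_scale_tens. Qed.

End RegularBimodule.

Definition eventually_periodic_algebra (k : fieldType) (A : falgType k) : Prop :=
  eventually_periodic (regular_bimodule A).

Definition Gorenstein (k : fieldType) (A : falgType k) : Prop :=
  inj_dim (A^o : lmodType A) != None /\
  inj_dim ((A^c)^o : lmodType A^c) != None.

(* Main.v *)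
Require Import Defs.
From HB Require Import structures.
From mathcomp Require Import all_boot all_order all_algebra all_field.
From mathcomp Require Import boolp functions classical_sets.
Import GRing.Theory.
Local Open Scope ring_scope.

Set Implicit Arguments.
Unset Strict Implicit.
Unset Printing Implicit Defensive.

(** Let E be the enveloping algebra of A, B the regular bimodule, X_j the syzygies
    in a resolution of B by free modules P_j of finite rank over E. The theorem
    follows from the equivalence, for every n, of
      (G) B has a resolution of length n by totally reflexive modules;
      (E) the extension groups of B by E vanish in all degrees above n;
      (I) A has an injective resolution of length n as a left module;
    and of (I) for right modules. Then the Gorenstein dimension of B and both
    self-injective dimensions of A are infima of the same set.

    Periodicity enters through one consequence: under (E), X_n is a direct summand
    of X_{n+N}, up to projectives, for arbitrarily large N ([syz_recurrent]).
    Eventual periodicity gives this far out in the resolution, and since taking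
    syzygies is fully faithful up to projectives on modules without extensions by
    E, it descends to X_n.

    (G) implies (E) by dimension shifting ([Gres_extv]). Conversely, under (E) the
    resolution stays exact after dualising beyond degree n. Hence X_j is reflexive
    for j large, and an extension class of degree i of the dual of X_j by E can be
    moved i steps towards the start of the resolution, where it vanishes if j is
    large compared with i; recurrence brings both facts back to X_n
    ([syz_totally_reflexive]).

    For (E) and (I), let H(X) be the maps of left modules from X to A, with the
    left module structure coming from the right action on X. The sequence
    H(P_0), H(P_1), ... is an injective resolution of H(B) = A with cosyzygies
    H(X_j), because B is projective on the left and H(P_j) is coinduced from vector
    spaces; so (I) says that H(X_n) is injective ([injres_regular]). If it is, the
    surjections from H(P_j) to H(X_{j+1}) split for j >= n, and the splittings
    extend maps from X_{j+1} to E ([cosyz_injective_ext]). Now assume (E). A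
    bimodule map from X_{n+N} to X_n, with N >= n and N > 0, descends to compatible
    maps from X_{j+N} to X_j for all j <= n. The induced map from H(X_0) = A to
    H(X_N) lifts to the injective module H(P_{N-1}), as A is projective; and since
    cosyzygies are functorial up to injectives, the map from H(X_n) to H(X_{n+N})
    factors through an injective as well ([homS_map_factors]). Applied to the
    recurrence of X_n, this makes the identity of H(X_n) factor through an
    injective module. *)

(** * Linear maps and short exact sequences *)

Section LinearMaps.
Variable R : pzRingType.
Implicit Types K L M N P Q W : lmodType R.

Definition mklin M N (f : M -> N) (lf : linear f) : {linear M -> N} :=
  HB.pack f (GRing.isLinear.Build R M N _ f lf).

(** Every map built below by a choice of preimages (descent to a quotient,
    corestriction, extension) is obtained from its graph. *)
Lemma linear_of_graph M N (G : M -> N -> Prop) :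
  (forall x, exists y, G x y) ->
  (forall a x x' y y', G x y -> G x' y' -> G (a *: x + x') (a *: y + y')) ->
  (forall y, G 0 y -> y = 0) ->
  exists h : {linear M -> N}, forall x, G x (h x).
Proof.
move=> tot lin fct.
have [h hG] := choice tot.
have uniq x y y' : G x y -> G x y' -> y = y'.
  move=> Gy Gy'; have := lin (-1) _ _ _ _ Gy' Gy.
  by rewrite scaleN1r addNr scaleN1r addrC => /fct /subr0_eq.
have lh : linear h by move=> a x y; apply: uniq (hG _) _; exact: lin.
by exists (mklin lh).
Qed.

Definition ses K P M (i : {linear K -> P}) (p : {linear P -> M}) : Prop :=
  [/\ injective i, exact_at i p & onto p].

Lemma ses_comp0 K P M (i : {linear K -> P}) (p : {linear P -> M}) x :
  ses i p -> p (i x) = 0.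
Proof. by case=> _ ex _; apply/ex; exists x. Qed.

Lemma injective0 M N (f : {linear M -> N}) :
  (forall x, f x = 0 -> x = 0) -> injective f.
Proof.
by move=> f0 x y fxy; apply/subr0_eq/f0; rewrite linearB fxy subrr.
Qed.

Lemma ses_factor_quotient K P M (i : {linear K -> P}) (p : {linear P -> M})
    N (f : {linear P -> N}) :
  ses i p -> (forall x, f (i x) = 0) ->
  exists g : {linear M -> N}, forall y, g (p y) = f y.
Proof.
move=> [_ ex po] f0.
pose G m n := exists2 y, p y = m & f y = n.
have [|||h hG] := @linear_of_graph M N G.
- by move=> m; have [y ym] := po m; exists (f y), y.
- move=> a _ _ _ _ [y <- <-] [y' <- <-]; exists (a *: y + y');
    by rewrite linearP.
- by move=> _ [y /ex [x <-] <-].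
exists h => y; have [z zy <-] := hG (p y).
apply/subr0_eq; rewrite -linearB.
have [x <-] : exists x, i x = z - y by apply/ex; rewrite linearB zy subrr.
exact: f0.
Qed.

Lemma ses_factor_kernel K P M (i : {linear K -> P}) (p : {linear P -> M})
    N (f : {linear N -> P}) :
  injective i -> exact_at i p -> (forall x, p (f x) = 0) ->
  exists g : {linear N -> K}, forall y, i (g y) = f y.
Proof.
move=> inj_i ex f0.
have [|||h hG] := @linear_of_graph N K (fun n x => i x = f n).
- by move=> n; apply/ex.
- by move=> a x x' y y' e e'; rewrite !linearP e e'.
- by move=> y; rewrite linear0 -(linear0 i) => /inj_i.
by exists h.
Qed.

Lemma ses_map_right K P M (i : {linear K -> P}) (p : {linear P -> M})
    K' P' M' (i' : {linear K' -> P'}) (p' : {linear P' -> M'})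
    (a : {linear K -> K'}) (b : {linear P -> P'}) :
  ses i p -> ses i' p' -> (forall x, b (i x) = i' (a x)) ->
  exists c : {linear M -> M'}, forall y, c (p y) = p' (b y).
Proof.
move=> s s' ba; have [x|c cp] := ses_factor_quotient (f := p' \o b) s.
  by rewrite /= ba (ses_comp0 _ s').
by exists c => y; rewrite cp.
Qed.

Lemma ses_map_left K P M (i : {linear K -> P}) (p : {linear P -> M})
    K' P' M' (i' : {linear K' -> P'}) (p' : {linear P' -> M'})
    (b : {linear P -> P'}) (c : {linear M -> M'}) :
  ses i p -> ses i' p' -> (forall y, p' (b y) = c (p y)) ->
  exists a : {linear K -> K'}, forall x, i' (a x) = b (i x).
Proof.
move=> s [inj' ex' _] bc.
have [x|a ia] := ses_factor_kernel (f := b \o i) inj' ex'.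
  by rewrite /= bc (ses_comp0 _ s) linear0.
by exists a => y; rewrite ia.
Qed.

Lemma ses_section_of_retraction K P M (i : {linear K -> P})
    (p : {linear P -> M}) (r : {linear P -> K}) :
  ses i p -> (forall x, r (i x) = x) ->
  exists s : {linear M -> P}, forall m, p (s m) = m.
Proof.
move=> S ri; have [|s sp] := ses_factor_quotient (f := idfun \- (i \o r)) S.
  by move=> x; rewrite /= ri subrr.
exists s => m; have [_ _ /(_ m) [y <-]] := S.
by rewrite sp /= linearB (ses_comp0 _ S) subr0.
Qed.

Lemma ses_retraction_of_section K P M (i : {linear K -> P})
    (p : {linear P -> M}) (s : {linear M -> P}) :
  ses i p -> (forall m, p (s m) = m) ->
  exists r : {linear P -> K}, forall x, r (i x) = x.
Proof.
move=> S ps; have [inj ex _] := S.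
have [|r ir] := ses_factor_kernel (f := idfun \- (s \o p)) inj ex.
  by move=> x; rewrite /= linearB ps subrr.
exists r => x; apply: inj.
by rewrite ir /= (ses_comp0 _ S) linear0 subr0.
Qed.

Lemma ses_iso_right K P M M' (i : {linear K -> P}) (p : {linear P -> M})
    (f : {linear M -> M'}) : ses i p -> bijective f -> ses i (f \o p).
Proof.
move=> [inj ex po] [g fK gK]; split=> // [y|m] /=.
  rewrite -ex; split=> [|->]; last by rewrite linear0.
  by rewrite -(linear0 f) => /(can_inj fK).
by have [y py] := po (g m); exists y; rewrite py gK.
Qed.

Lemma bij_lin_inv M N (f : {linear M -> N}) : bijective f ->
  exists g : {linear N -> M}, cancel f g /\ cancel g f.
Proof.
case=> g fK gK; have lg : linear g.
  by move=> a x y; apply: (can_inj fK); rewrite linearP !gK.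
by exists (mklin lg).
Qed.

Lemma inj_onto_bij M N (f : {linear M -> N}) :
  injective f -> onto f -> bijective f.
Proof.
move=> inj fo; have [g gK] := choice fo.
by exists g => // x; apply: inj; rewrite gK.
Qed.

End LinearMaps.

(** * Submodules *)

(** The proof of closedness is an argument of the predicate so that the
    closedness instance can be attached to it. *)
Definition submod_pred (R : pzRingType) (M : lmodType R) (S : M -> Prop)
  (_ : submod_closed (fun x => `[<S x>])) : {pred M} := fun x => `[<S x>].

Section Submodule.
Variables (R : pzRingType) (M : lmodType R) (S : M -> Prop).
Hypothesis closedS : submod_closed (fun x : M => `[<S x>]).

Lemma submod_pred_closed : submod_closed (submod_pred closedS).
Proof. exact: closedS. Qed.

HB.instance Definition _ :=
  GRing.isSubmodClosed.Build _ _ (submod_pred closedS) submod_pred_closed.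

Record submod := Submod { submod_val : M; _ : submod_val \in submod_pred closedS }.

HB.instance Definition _ := [isSub for submod_val].
HB.instance Definition _ := [Choice of submod by <:].
HB.instance Definition _ := [SubChoice_isSubLmodule of submod by <:].

Lemma submodP (u : submod) : S (val u).
Proof. exact/asboolP/(valP u). Qed.

End Submodule.

Section SubmoduleSes.
Variable R : pzRingType.
Implicit Types M N P : lmodType R.

Lemma submod_exists M (S : M -> Prop) : S 0 ->
  (forall a x y, S x -> S y -> S (a *: x + y)) ->
  exists (K : lmodType R) (i : {linear K -> M}),
    injective i /\ forall y, S y <-> exists x, i x = y.
Proof.
move=> S0 SP; have cS : submod_closed (fun x : M => `[<S x>]).
  split=> [|a x y /asboolP Sx /asboolP Sy]; apply/asboolP => //; exact: SP.
have lv : linear (val : submod cS -> M) by move=> a x y; rewrite linearP.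
exists (submod cS), (mklin lv); split=> [|y]; first exact: val_inj.
split=> [Sy|[x <-]]; last exact: submodP.
have Py : y \in submod_pred cS by apply/asboolP.
by exists (Submod Py).
Qed.

Lemma ker_exists M N (f : {linear M -> N}) :
  exists (K : lmodType R) (i : {linear K -> M}), injective i /\ exact_at i f.
Proof.
have [||K [i iP]] := @submod_exists M (fun x => f x = 0).
- exact: linear0.
- by move=> a x y fx fy; rewrite linearP fx fy scaler0 addr0.
by exists K, i.
Qed.

Lemma ses_of_onto M N (f : {linear M -> N}) : onto f ->
  exists (K : lmodType R) (i : {linear K -> M}), ses i f.
Proof. by move=> fo; have [K [i [inj ex]]] := ker_exists f; exists K, i. Qed.

Lemma im_exists M N (f : {linear M -> N}) :
  exists (I : lmodType R) (p : {linear M -> I}) (i : {linear I -> N}),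
    [/\ onto p, injective i & forall x, i (p x) = f x].
Proof.
have [||I [i [inj iP]]] := @submod_exists N (fun y => exists x, f x = y).
- by exists 0; rewrite linear0.
- by move=> a _ _ [x <-] [y <-]; exists (a *: x + y); rewrite linearP.
have [p pP] : exists p : {linear M -> I}, forall x, i (p x) = f x.
  apply: (@linear_of_graph R M I (fun x y => i y = f x)).
  - by move=> x; apply/iP; exists x.
  - by move=> a x x' y y' e e'; rewrite !linearP e e'.
  - by move=> y; rewrite linear0 -(linear0 i) => /inj.
exists I, p, i; split=> // z.
have [x xz] : exists x, f x = i z by apply/iP; exists z.
by exists x; apply: inj; rewrite pP.
Qed.

End SubmoduleSes.

(** * Free modules of finite rank *)

Section Free.
Variable R : pzRingType.
Implicit Types A B C F K L M N P Q W T : lmodType R.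

Definition gen_map M t (m : 'I_t -> M) (v : 'rV[R]_t) : M :=
  \sum_s v 0 s *: m s.

Lemma gen_map_linear M t (m : 'I_t -> M) : linear (gen_map m).
Proof.
move=> a v w; rewrite /gen_map scaler_sumr -big_split /=.
by apply: eq_bigr => s _; rewrite !mxE scalerDl scalerA.
Qed.

Lemma row_basis t (v : 'rV[R]_t) : v = \sum_s v 0 s *: delta_mx 0 s.
Proof. exact: row_sum_delta. Qed.

Lemma free_linear_eq M t (f g : {linear 'rV[R]_t -> M}) :
  (forall s, f (delta_mx 0 s) = g (delta_mx 0 s)) -> f =1 g.
Proof.
move=> fg v; rewrite (row_basis v) !linear_sum; apply: eq_bigr => s _.
by rewrite !linearZ fg.
Qed.

Lemma gen_map_delta M t (m : 'I_t -> M) s : gen_map m (delta_mx 0 s) = m s.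
Proof.
rewrite /gen_map (bigD1 s) //= big1 => [|r rs]; rewrite !mxE ?eqxx /=.
  by rewrite scale1r addr0.
by rewrite (negPf rs) scale0r.
Qed.

Lemma free_projective t : projective_module 'rV[R]_t.
Proof.
move=> M N f g fo; have [m mP] := choice (fun s => fo (g (delta_mx 0 s))).
exists (mklin (gen_map_linear m)) => v.
apply: (@free_linear_eq N t (f \o mklin (gen_map_linear m))) => s /=.
by rewrite gen_map_delta mP.
Qed.

Lemma coord_linear t s : linear (fun v : 'rV[R]_t => v 0 s : R^o).
Proof. by move=> a v w; rewrite !mxE. Qed.

Lemma row_linear M t (g : 'I_t -> {linear M -> R^o}) :
  linear (fun y => \row_s (g s y : R)).
Proof. by move=> a x y; apply/rowP => s; rewrite !mxE linearP. Qed.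

Lemma fin_gen_free M :
  fin_gen M <-> exists t (p : {linear 'rV[R]_t -> M}), onto p.
Proof.
split=> [[t [g gP]]|[t [p po]]].
  exists t, (mklin (gen_map_linear g)) => x; have [c ->] := gP x.
  by exists (\row_s c s); apply: eq_bigr => s _; rewrite mxE.
exists t, (fun s => p (delta_mx 0 s)) => x; have [v <-] := po x.
exists (fun s => v 0 s); rewrite {1}(row_basis v) linear_sum.
by apply: eq_bigr => s _; rewrite linearZ.
Qed.

Lemma fin_gen_onto M N (f : {linear M -> N}) : onto f -> fin_gen M -> fin_gen N.
Proof.
move=> fo /fin_gen_free [t [p po]]; apply/fin_gen_free.
exists t, (f \o p) => y; have [x <-] := fo y; have [v <-] := po x.
by exists v.
Qed.

Lemma fin_gen_rV t : fin_gen 'rV[R]_t.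
Proof. by apply/fin_gen_free; exists t, idfun => x; exists x. Qed.

Definition noetherian : Prop :=
  forall M N (i : {linear M -> N}), injective i -> fin_gen N -> fin_gen M.

Lemma prod_projective P Q :
  projective_module P -> projective_module Q -> projective_module (P * Q)%type.
Proof.
move=> pP pQ M N f g fo.
have lP : linear (fun x : P => g (x, 0)).
  move=> a x y; rewrite -linearP; congr (g (_, _)).
  by rewrite /= scaler0 addr0.
have lQ : linear (fun y : Q => g (0, y)).
  move=> a x y; rewrite -linearP; congr (g (_, _)).
  by rewrite /= scaler0 addr0.
have [hP hPE] := pP M N f (mklin lP) fo; have [hQ hQE] := pQ M N f (mklin lQ) fo.
have lh : linear (fun z : P * Q => hP z.1 + hQ z.2).
  move=> a x y; rewrite !linearP scalerDr addrACA.
  by congr (_ + _).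
exists (mklin lh) => -[x y] /=; rewrite linearD hPE hQE /= -linearD.
by congr (g (_, _)); rewrite /= ?addr0 ?add0r.
Qed.

End Free.
Arguments noetherian : clear implicits.
Arguments free_projective R t : clear implicits.

(** * Modules up to projective summands *)

Section Stable.
Variable R : pzRingType.
Implicit Types A B C F K L M N P Q W T : lmodType R.

(** The relation of being a direct summand in the stable category, where maps
    that factor through a projective module are zero. Periodicity is used only
    in this weakened form, so that the minimal syzygies can be traded for those
    of a free resolution. *)
Definition st_retract W' W : Prop :=
  exists (u : {linear W' -> W}) (v : {linear W -> W'}) Q
         (b : {linear W' -> Q}) (c : {linear Q -> W'}),
    projective_module Q /\ forall x, x = v (u x) + c (b x).

Lemma st_retract_iso W' W : module_iso W' W -> st_retract W' W.
Proof.
case=> f /bij_lin_inv[g [fK _]].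
exists f, g, 'rV[R]_0, \0, \0; split; first exact: free_projective.
by move=> x; rewrite fK /= addr0.
Qed.

Lemma st_retract_isoV W' W : module_iso W' W -> st_retract W W'.
Proof.
case=> f /bij_lin_inv[g [fK gK]]; apply: st_retract_iso.
by exists g; exists f.
Qed.

Lemma st_retract_trans L M N : st_retract L M -> st_retract M N ->
  st_retract L N.
Proof.
move=> [u [v [Q [b [c [pQ E]]]]]] [u' [v' [Q' [b' [c' [pQ' E']]]]]].
have lb : linear (fun x => (b x, b' (u x)) : Q * Q').
  by move=> a x y; rewrite !linearP.
have lc : linear (fun z : Q * Q' => c z.1 + v (c' z.2)).
  by move=> a x y; rewrite !linearP scalerDr addrACA.
exists (u' \o u), (v \o v'), (Q * Q')%type, (mklin lb), (mklin lc).
split=> [|x /=]; first exact: prod_projective.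
rewrite {1}(E x) {1}(E' (u x)) linearD -!addrA; congr (_ + _).
by rewrite addrC.
Qed.

(** Maps out of a projective lift along surjections, so the projective in the
    error term can be exchanged for any cover [P] of [W']. *)
Lemma st_retract_cover W' W P (q : {linear P -> W'}) : onto q ->
  st_retract W' W ->
  exists (u : {linear W' -> W}) (v : {linear W -> W'}) (b : {linear W' -> P}),
    forall x, x = v (u x) + q (b x).
Proof.
move=> qo [u [v [Q [b [c [pQ E]]]]]]; have [d dE] := pQ P W' q c qo.
by exists u, v, (d \o b) => x; rewrite /= dE.
Qed.

Definition extends K P (i : {linear K -> P}) N : Prop :=
  forall f : {linear K -> N}, exists g : {linear P -> N}, forall x, g (i x) = f x.

Lemma extends_free K P (i : {linear K -> P}) t :
  extends i R^o -> extends i 'rV[R]_t.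
Proof.
move=> ext f.
have [g gE] := choice (fun s => ext (mklin (coord_linear s) \o f)).
exists (mklin (row_linear g)) => x; apply/rowP => s.
by rewrite mxE gE.
Qed.

(** Comparison of two projective presentations: all maps lift to the
    projectives, and what the lifts fail to satisfy takes values in the kernel
    [K']. Both consequences below, for syzygies and for extension groups, read
    the resulting identity on [K']. *)
Lemma st_retract_lift K P M (i : {linear K -> P}) (p : {linear P -> M})
    K' P' M' (i' : {linear K' -> P'}) (p' : {linear P' -> M'}) :
  ses i p -> ses i' p' -> projective_module P -> projective_module P' ->
  st_retract M' M ->
  exists (ut : {linear P' -> P}) (a : {linear K' -> K}) (c : {linear K -> K'})
         (s : {linear P' -> K'}),
    (forall x, i (a x) = ut (i' x)) /\ (forall x, x = c (a x) + s (i' x)).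
Proof.
move=> S S' pP pP' [u [v [Q [b [c [pQ E]]]]]].
have [inj ex po] := S; have [inj' ex' po'] := S'.
have [ut utE] := pP' P M p (u \o p') po.
have [vt vtE] := pP P' M' p' (v \o p) po'.
have [ct ctE] := pQ P' M' p' c po'.
have [a aE] := ses_map_left S' S utE; have [d dE] := ses_map_left S S' vtE.
pose e := idfun \- ((vt \o ut) \+ (ct \o (b \o p'))).
have [y|s sE] := ses_factor_kernel (f := e) inj' ex'.
  rewrite /e /= linearB linearD vtE ctE /= utE /= {1}(E (p' y)).
  by rewrite subrr.
exists ut, a, d, s; split=> // x; apply: inj'.
rewrite linearD sE dE aE /e /= (ses_comp0 _ S') !linear0 addr0.
by rewrite addrC subrK.
Qed.

Lemma st_retract_syzygy K P M (i : {linear K -> P}) (p : {linear P -> M})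
    K' P' M' (i' : {linear K' -> P'}) (p' : {linear P' -> M'}) :
  ses i p -> ses i' p' -> projective_module P -> projective_module P' ->
  st_retract M' M -> st_retract K' K.
Proof.
move=> S S' pP pP' rM; have [_ [a [c [s [_ E]]]]] := st_retract_lift S S' pP pP' rM.
by exists a, c, P', i', s.
Qed.

(** Taking syzygies is fully faithful, up to projectives, on modules whose
    extensions by projectives split: this lets a stable retraction descend. *)
Lemma st_retract_cosyzygy K P M (i : {linear K -> P}) (p : {linear P -> M})
    K' P' M' (i' : {linear K' -> P'}) (p' : {linear P' -> M'})
    F (q : {linear F -> K'}) :
  ses i p -> ses i' p' -> projective_module P' -> onto q ->
  extends i P' -> extends i' P -> extends i' F ->
  st_retract K' K -> st_retract M' M.
Proof.
move=> S S' pP' qo eP' eP eF /(st_retract_cover qo)[u [v [b E]]].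
have [ut utE] := eP (i \o u); have [vt vtE] := eP' (i' \o v).
have [bt btE] := eF b.
have [U UE] := ses_map_right S' S utE; have [V VE] := ses_map_right S S' vtE.
pose e := idfun \- ((vt \o ut) \+ (i' \o (q \o bt))).
have [x|s sE] := ses_factor_quotient (f := e) S'.
  rewrite /e /= utE /= vtE /= btE -linearD -linearB -E subrr.
  exact: linear0.
exists U, V, P', s, p'; split=> // m; have [_ _ /(_ m) [y <-]] := S'.
rewrite sE UE VE /e /= linearB linearD (ses_comp0 _ S') addr0 addrC.
by rewrite subrK.
Qed.

Lemma extends_st_retract K P M (i : {linear K -> P}) (p : {linear P -> M})
    K' P' M' (i' : {linear K' -> P'}) (p' : {linear P' -> M'}) N :
  ses i p -> ses i' p' -> projective_module P -> projective_module P' ->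
  st_retract M' M -> extends i N -> extends i' N.
Proof.
move=> S S' pP pP' rM ext f.
have [ut [a [c [s [aE E]]]]] := st_retract_lift S S' pP pP' rM.
have [g gE] := ext (f \o c).
exists ((g \o ut) \+ (f \o s)) => x.
by rewrite /= -aE gE /= -linearD -E.
Qed.

End Stable.

(** * Free resolutions and the vanishing of extension groups *)

Section Resolutions.
Variable R : pzRingType.
Implicit Types A B C F K L M N P Q W T : lmodType R.

(** The syzygies belong to the data since they, rather than the differentials,
    are what gets compared. *)
Record resolution := Resolution {
  syz : nat -> lmodType R;
  rk : nat -> nat;
  rincl : forall j, {linear syz j.+1 -> 'rV[R]_(rk j)};
  rproj : forall j, {linear 'rV[R]_(rk j) -> syz j};
  res_ses : forall j, ses (rincl j) (rproj j) }.

Lemma syz_fin_gen (X : resolution) j : fin_gen (syz X j).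
Proof.
apply: (fin_gen_onto (f := rproj X j)); last exact: fin_gen_rV.
by case: (res_ses X j).
Qed.

Lemma fg_presentation M : noetherian R -> fin_gen M ->
  exists K t (i : {linear K -> 'rV[R]_t}) (p : {linear 'rV[R]_t -> M}),
    fin_gen K /\ ses i p.
Proof.
move=> noe /fin_gen_free[t [p po]]; have [K [i S]] := ses_of_onto po.
exists K, t, i, p; split=> //.
by case: S => inj _ _; exact: (noe _ _ i inj (fin_gen_rV R t)).
Qed.

Lemma resolution_exists M : noetherian R -> fin_gen M ->
  exists X : resolution, module_iso (syz X 0) M.
Proof.
move=> noe fgM; pose T : Type := {M : lmodType R | fin_gen M}.
pose D (M N : T) := {t : nat &
  {i : {linear sval N -> 'rV[R]_t} & {p : {linear 'rV[R]_t -> sval M} | ses i p}}}.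
have next (N : T) : {N' : T & D N N'}.
  apply: inhabited_witness.
  case: N => N fgN; have [K [t [i [p [fgK S]]]]] := fg_presentation noe fgN.
  by split; exists (exist _ K fgK), t, i, p.
pose s j := iter j (fun N : T => projT1 (next N)) (exist _ M fgM : T).
pose d j : D (s j) (s j.+1) := projT2 (next (s j)).
exists (@Resolution (fun j => sval (s j)) (fun j => projT1 (d j))
  (fun j => projT1 (projT2 (d j))) (fun j => sval (projT2 (projT2 (d j))))
  (fun j => svalP (projT2 (projT2 (d j))))).
by exists idfun; exists idfun.
Qed.

(** Vanishing of the extension group of degree [j.+1], by dimension shifting.
    Asking for one presentation at each stage makes it easy to establish;
    [extv_res_st_retract] recovers the condition on every resolution. *)
Fixpoint extv j W N : Prop :=
  match j with
  | 0 => exists K P (i : {linear K -> P}) (p : {linear P -> W}),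
      [/\ ses i p, projective_module P & extends i N]
  | j'.+1 => exists K P (i : {linear K -> P}) (p : {linear P -> W}),
      [/\ ses i p, projective_module P & extv j' K N]
  end.

Lemma extv_iso j W W' N : module_iso W W' -> extv j W N -> extv j W' N.
Proof.
case=> f bf; case: j => [|j] [K [P [i [p [S pP eN]]]]];
  exists K, P, i, (f \o p); split=> //; exact: ses_iso_right.
Qed.

(** Each stable retraction of modules induces one of syzygies, so that the
    presentations behind [extv] can be compared with a given resolution. *)
Lemma extv_res_st_retract (X : resolution) j l W N :
  extv j W N -> st_retract (syz X l) W -> extends (rincl X (j + l)) N.
Proof.
elim: j l W => [|j IHj] l W [K [P [i [p [S pP eN]]]]] r.
  exact: (extends_st_retract S (res_ses X l) pP (free_projective _ _) r eN).
rewrite addSnnS; apply: IHj eN _.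
exact: st_retract_syzygy S (res_ses X l) pP (free_projective _ _) r.
Qed.

Lemma extv_of_res (X : resolution) j l N :
  extends (rincl X (j + l)) N -> extv j (syz X l) N.
Proof.
elim: j l => [|j IHj] l ext;
  exists (syz X l.+1), 'rV[R]_(rk X l), (rincl X l), (rproj X l);
  split=> //; try exact: res_ses; try exact: free_projective.
by apply: IHj; rewrite -addSnnS.
Qed.

Lemma extv_projective j W N : projective_module W -> extv j W N.
Proof.
have S P : ses (\0 : {linear 'rV[R]_0 -> P}) idfun.
  split=> [x y _|y|y]; last by exists y.
    by apply/rowP => -[].
  by split=> [/= ->|[x <-]] //; exists 0.
elim: j W => [|j IHj] W pW; exists 'rV[R]_0, W, \0, idfun; split=> //.
  move=> f; exists \0 => x /=; have -> : x = 0 by apply/rowP => -[].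
  by rewrite linear0.
exact/IHj/free_projective.
Qed.

(** The long exact sequence at the middle term, by the horseshoe lemma. *)
Lemma extv_extension j A B C (a : {linear A -> B}) (c : {linear B -> C}) N :
  ses a c -> extv j A N -> extv j C N -> extv j B N.
Proof.
have horseshoe (A' B' C' : lmodType R) (a' : {linear A' -> B'}) (c' : {linear B' -> C'})
    (KA PA : lmodType R) (iA : {linear KA -> PA}) (pA : {linear PA -> A'})
    (KC PC : lmodType R) (iC : {linear KC -> PC}) (pC : {linear PC -> C'}) :
    ses a' c' -> ses iA pA -> ses iC pC ->
    projective_module PA -> projective_module PC ->
  exists (KB : lmodType R) (i : {linear KB -> (PA * PC)%type})
      (p : {linear (PA * PC)%type -> B'})
      (al : {linear KA -> KB}) (ga : {linear KB -> KC}),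
    [/\ @ses R KB (PA * PC)%type B' i p, ses al ga, forall x, i (al x) = (iA x, 0)
      & forall z, iC (ga z) = (i z).2].
  move=> S SA SC pPA pPC; have [inja exa oc] := S.
  have [injA exA oA] := SA; have [injC exC oC] := SC.
  have [l lE] := pPC _ _ c' pC oc.
  have lp : linear (fun z : PA * PC => a' (pA z.1) + l z.2).
    by move=> x y z; rewrite !linearP scalerDr addrACA.
  have po : onto (mklin lp).
    move=> y; have [z zE] := oC (c' y).
    have [x xE] : exists x, a' x = y - l z.
      by apply/exa; rewrite linearB lE zE subrr.
    have [w wE] := oA x; exists (w, z) => /=.
    by rewrite wE xE subrK.
  have [KB [i SB]] := ses_of_onto po; have [injB exB _] := SB.
  have c'p z : c' (mklin lp z) = pC z.2.
    by rewrite /= linearD (ses_comp0 _ S) add0r lE.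
  have l1 : linear (fun x => (iA x, 0) : PA * PC).
    by move=> e x y; rewrite linearP; congr pair; rewrite /= scaler0 addr0.
  have [x|al alE] := ses_factor_kernel (f := mklin l1) injB exB.
    by rewrite /= (ses_comp0 _ SA) !linear0 addr0.
  have l2 : linear (fun z : KB => (i z).2) by move=> e x y; rewrite linearP.
  have [z|ga gaE] := ses_factor_kernel (f := mklin l2) injC exC.
    by rewrite /= -c'p (ses_comp0 _ SB) linear0.
  exists KB, i, (mklin lp), al, ga; split=> //; split.
  - by move=> x y /(congr1 i); rewrite !alE => -[/injA].
  - move=> z; split=> [ga0|[x <-]].
      have i20 : (i z).2 = 0 by rewrite -[LHS]gaE ga0 linear0.
      have pz0 : a' (pA (i z).1) = a' 0.
        have := ses_comp0 z SB; rewrite /= i20 !linear0 addr0 => ->.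
        by [].
      have [x xE] := (exA _).1 (inja _ _ pz0).
      exists x; apply: injB; rewrite alE /= xE.
      by case: (i z) i20 => /= y1 y2 ->.
    by apply: injC; rewrite gaE /= alE /= linear0.
  - move=> x; have : c' (l (iC x)) = 0 by rewrite lE (ses_comp0 _ SC).
    move=> /exa [y yE]; have [w wE] := oA (- y).
    have [z zE] : exists z, i z = (w, iC x).
      by apply/exB; rewrite /= wE linearN yE addNr.
    by exists z; apply: injC; rewrite gaE /= zE.
elim: j A B C a c => [|j IHj] A B C a c S;
    move=> [KA [PA [iA [pA [SA pPA eA]]]]] [KC [PC [iC [pC [SC pPC eC]]]]];
    have [KB [i [p [al [ga [SB SK alE gaE]]]]]] :=
      horseshoe _ _ _ _ _ _ _ _ _ _ _ _ _ S SA SC pPA pPC;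
    exists KB, (PA * PC)%type, i, p; split=> //; try exact: prod_projective.
  move=> f; have [g gE] := eA (f \o al).
  have l1 : linear (fun z : PA * PC => g z.1) by move=> e x y; rewrite linearP.
  have [x|h hE] := ses_factor_quotient (f := f \- (mklin l1 \o i)) SK.
    by rewrite /= alE gE subrr.
  have [k kE] := eC h.
  have l2 : linear (fun z : PA * PC => g z.1 + k z.2).
    by move=> e x y; rewrite !linearP scalerDr addrACA.
  exists (mklin l2) => z /=; rewrite -gaE kE hE /=.
  by rewrite addrC subrK.
exact: IHj SK eA eC.
Qed.

(** For a cover of [T] by a projective, the kernel of the composite cover of [M]
    is an extension of [K] by a syzygy of [T]. *)
Lemma extv_shift j K T M (i : {linear K -> T}) (p : {linear T -> M}) N :
  ses i p -> extv j.+1 T N -> extv j K N -> extv j.+1 M N.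
Proof.
move=> S [Z [P [i' [p' [S' pP eZ]]]]] eK.
have [inj ex po] := S; have [inj' ex' po'] := S'.
have oq : onto (p \o p').
  by move=> m; have [t <-] := po m; have [y <-] := po' t; exists y.
have [Z' [k SZ']] := ses_of_onto oq; have [injk exk _] := SZ'.
exists Z', P, k, (p \o p'); split=> //.
have [x|a aE] := ses_factor_kernel (f := i') injk exk.
  by rewrite /= (ses_comp0 _ S') linear0.
have [z|c cE] := ses_factor_kernel (f := p' \o k) inj ex.
  exact: (ses_comp0 z SZ').
apply: (extv_extension (a := a) (c := c)) eZ eK; split.
- by move=> x y /(congr1 k); rewrite !aE => /inj'.
- move=> z; split=> [cz|[x <-]]; last first.
    by apply: inj; rewrite cE /= aE (ses_comp0 _ S') linear0.
  have /ex'[x xE] : p' (k z) = 0 by rewrite -[LHS]cE cz linear0.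
  by exists x; apply: injk; rewrite aE.
- move=> x; have [y yE] := po' (i x).
  have /exk[z zE] : (p \o p') y = 0 by rewrite /= yE (ses_comp0 _ S).
  by exists z; apply: inj; rewrite cE /= zE.
Qed.

Lemma Ext_vanishes_extv j W N : Ext_vanishes j.+1 W N -> extv j W N.
Proof.
case=> P [d [e [[pP eo ex0 ex] coc]]].
elim: j W P d e pP eo ex0 ex coc => [|j IHj] W P d e pP eo ex0 ex coc;
  have [K [i S]] := ses_of_onto eo; have [inj exi _] := S;
  have [x|p pE] := ses_factor_kernel (f := d 0) inj exi;
  (try by apply/ex0; exists x).
  exists K, (P 0), i, e; split=> // f.
  have [x|g gE] := coc (f \o p).
    rewrite /=; have -> : p (d 1 x) = 0.
      by apply: inj; rewrite pE linear0; apply/ex; exists x.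
    exact: linear0.
  exists g => x.
  have [y yE] : exists y, d 0 y = i x by apply/ex0/(ses_comp0 x S).
  by rewrite -yE -gE /=; congr (f _); apply: inj; rewrite pE.
exists K, (P 0), i, e; split=> //.
apply: (IHj K (fun n => P n.+1) (fun n => d n.+1) p) => //.
- move=> x; have [y yE] : exists y, d 0 y = i x by apply/ex0/(ses_comp0 x S).
  by exists y; apply: inj; rewrite pE.
- move=> y; split=> [py|[x <-]].
    by apply/ex; rewrite -pE py linear0.
  by apply: inj; rewrite pE linear0; apply/ex; exists x.
Qed.

Lemma extv_Ext_vanishes j W N : noetherian R -> fin_gen W -> extv j W N ->
  Ext_vanishes j.+1 W N.
Proof.
move=> noe fgW eN; have [X isoX] := resolution_exists noe fgW.
have := extv_res_st_retract eN (st_retract_iso isoX); rewrite addn0 => ext.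
case: isoX => f bf.
exists (fun i => 'rV[R]_(rk X i)), (fun i => rincl X i \o rproj X i.+1),
  (f \o rproj X 0).
have kerd i y : rincl X i (rproj X i.+1 y) = 0 <-> rproj X i.+1 y = 0.
  have [inj _ _] := res_ses X i; split=> [|->]; last exact: linear0.
  by rewrite -(linear0 (rincl X i)) => /inj.
split; first split.
- by move=> i; exact: free_projective.
- by case: (ses_iso_right (res_ses X 0) bf).
- have [_ ex _] := ses_iso_right (res_ses X 0) bf; move=> y; rewrite ex.
  split=> [[x <-]|[x <-]]; last by exists (rproj X 1 x).
  by have [_ _ /(_ x)[z <-]] := res_ses X 1; exists z.
- move=> i y /=; rewrite kerd.
  have [_ -> _] := res_ses X i.+1; split=> [[x <-]|[x <-]].
    by have [_ _ /(_ x)[z <-]] := res_ses X i.+2; exists z.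
  by exists (rproj X i.+2 x).
move=> g coc; have [x|h hE] := ses_factor_quotient (f := g) (res_ses X j.+1).
  by have [_ _ /(_ x)[z <-]] := res_ses X j.+2; exact: coc.
have [k kE] := ext h; exists k => x.
by rewrite /= kE hE.
Qed.

(** * Recurrence of syzygies *)

(** Syzygies taken with projective covers agree, up to projectives, with those
    of a free resolution. *)
Lemma is_syzygy_res (X : resolution) n M K l : is_syzygy n M K ->
  st_retract M (syz X l) -> st_retract (syz X l) M ->
  st_retract K (syz X (n + l)) /\ st_retract (syz X (n + l)) K.
Proof.
elim: n K => [|n IHn] K /=.
  move=> MK MX XM; split; first exact: st_retract_trans (st_retract_isoV MK) MX.
  exact: st_retract_trans XM (st_retract_iso MK).
move=> [L [sL [P [p [i [[pP po _] inj ex]]]]]] MX XM.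
have [r1 r2] := IHn _ sL MX XM; have S : ses i p by [].
have pF := free_projective R (rk X (n + l)); have SX := res_ses X (n + l).
by split; [exact: st_retract_syzygy SX S pF pP r1
          |exact: st_retract_syzygy S SX pP pF r2].
Qed.

Lemma eventually_periodic_res (X : resolution) M : module_iso (syz X 0) M ->
  eventually_periodic M ->
  exists m p, (0 < p)%N /\ st_retract (syz X m) (syz X (p + m)).
Proof.
move=> isoX [m [K [sK [p [p0 pK]]]]]; exists m, p; split=> //.
have [r1 r2] := is_syzygy_res sK (st_retract_isoV isoX) (st_retract_iso isoX).
rewrite addn0 in r1 r2; have [r3 _] := is_syzygy_res pK r1 r2.
exact: st_retract_trans r2 r3.
Qed.

Lemma syz_st_retract_up (X : resolution) a l l' :
  st_retract (syz X l) (syz X l') -> st_retract (syz X (a + l)) (syz X (a + l')).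
Proof.
move=> r; elim: a => //= a IHa.
exact: st_retract_syzygy (res_ses X (a + l')) (res_ses X (a + l))
  (free_projective R _) (free_projective R _) IHa.
Qed.

Lemma syz_st_retract_down (X : resolution) (n N d : nat) :
  (forall j, (n <= j)%N -> extends (rincl X j) R^o) ->
  st_retract (syz X (d + n)) (syz X (N + (d + n))) ->
  st_retract (syz X n) (syz X (N + n)).
Proof.
move=> ext; elim: d => //= d IHd; rewrite addSn addnS => r; apply: IHd.
have nd : (n <= d + n)%N by exact: leq_addl.
have nd' : (n <= N + (d + n))%N by apply: leq_trans (leq_addl _ _).
have [_ _ qo] := res_ses X (d + n).+1.
by apply: st_retract_cosyzygy (res_ses X (N + (d + n))) (res_ses X (d + n))
  (free_projective R _) qo _ _ _ r; apply/extends_free/ext.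
Qed.

(** Iterating the period gives retractions of arbitrarily large amplitude far
    out in the resolution; these move up or down to the [n]-th syzygy. *)
Lemma syz_recurrent (X : resolution) m p n : (0 < p)%N ->
  st_retract (syz X m) (syz X (p + m)) ->
  (forall j, (n <= j)%N -> extends (rincl X j) R^o) ->
  forall a, exists2 b, (a <= b)%N & st_retract (syz X n) (syz X (b + n)).
Proof.
move=> p0 r ext a; exists (a * p)%N; first exact: leq_pmulr.
have {r}: st_retract (syz X m) (syz X (a * p + m)).
  elim: a => [|a IHr].
    by apply: st_retract_iso; exists idfun; exists idfun.
  apply: st_retract_trans IHr _.
  have := syz_st_retract_up (a * p) r.
  by rewrite addnA mulSn [(p + _)%N]addnC.
move: (a * p)%N => b r; have [mn|/ltnW nm] := leqP m n.
  have := syz_st_retract_up (n - m) r.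
  by rewrite addnCA subnK.
by apply: (syz_st_retract_down (d := m - n)) => //; rewrite subnK.
Qed.

End Resolutions.

(** * Duality *)

Section Duality.
Variable R : pzRingType.
Implicit Types K M N F P : lmodType R.

Lemma dual_linear M (f : dual M) : linear (dual_fun f : M -> R^o).
Proof. exact/asboolP/(dualP f). Qed.

Definition dual_lin M (f : dual M) : {linear M -> R^o} := mklin (dual_linear f).

Definition lin_dual M (g : {linear M -> R^o}) : dual M :=
  @Dual R M (g : M -> (R^c)^o) (asboolT (linearP g)).

Lemma dual_ext M (f g : dual M) :
  (forall x, dual_fun f x = dual_fun g x) -> f = g.
Proof. by move=> fg; apply/val_inj/funext. Qed.

Lemma dual_fun0 M (f : dual M) : dual_fun f 0 = 0.
Proof. exact: (linear0 (dual_lin f)). Qed.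

Definition dual_map M N (f : {linear M -> N}) (g : dual N) : dual M :=
  lin_dual (dual_lin g \o f).

Lemma dual_map_linear M N (f : {linear M -> N}) :
  linear (dual_map f : dual N -> dual M).
Proof.
move=> a g h; apply: dual_ext => x.
by rewrite dual_addE (dual_scaleE (a : R)).
Qed.

Definition dualm M N (f : {linear M -> N}) : {linear dual N -> dual M} :=
  mklin (dual_map_linear f).

(** Dualising is left exact, and extending functionals along [i] is what
    right exactness asks for. *)
Lemma dual_ses K P M (i : {linear K -> P}) (p : {linear P -> M}) :
  ses i p -> extends i R^o -> ses (dualm p) (dualm i).
Proof.
move=> S ext; have [_ _ po] := S; split.
- move=> f g /(congr1 (@dual_fun R P)) fg; apply: dual_ext => x.
  by have [y <-] := po x; have := congr1 (fun h => h y) fg.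
- move=> g; split=> [/(congr1 (@dual_fun R K)) gi0|[h <-]]; last first.
    by apply: dual_ext => x; rewrite /= (ses_comp0 x S) dual_fun0.
  have [x|h hE] := ses_factor_quotient (f := dual_lin g) S.
    exact: (congr1 (fun h => h x) gi0).
  by exists (lin_dual h); apply: dual_ext => y; exact: hE.
- move=> g; have [h hE] := ext (dual_lin g).
  by exists (lin_dual h); apply: dual_ext => y; exact: hE.
Qed.

End Duality.

Section FreeDuality.
Variable R : pzRingType.
Implicit Types K M N F P : lmodType R.

Definition coordd t (s : 'I_t) : dual 'rV[R]_t := lin_dual (mklin (coord_linear s)).

Lemma dual_free_basis t (f : dual 'rV[R]_t) :
  f = \sum_s (dual_fun f (delta_mx 0 s) : R^c) *: coordd s.
Proof.
apply: dual_ext => v.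
have -> : dual_fun (\sum_s (dual_fun f (delta_mx 0 s) : R^c) *: coordd s) v =
    \sum_s v 0 s * (dual_fun f (delta_mx 0 s) : R).
  elim/big_rec2: _ => // s y x _ <-; rewrite dual_addE.
  by rewrite (dual_scaleE (dual_fun f (delta_mx 0 s) : R)).
rewrite {1}(row_basis v) -[LHS]/(dual_lin f _) linear_sum.
by apply: eq_bigr => s _; rewrite linearZ.
Qed.

Lemma dual_free_projective t : projective_module (dual 'rV[R]_t).
Proof.
move=> M N f g fo; have [m mP] := choice (fun s => fo (g (coordd s))).
have l : linear (fun h : dual 'rV[R]_t =>
    \sum_s (dual_fun h (delta_mx 0 s) : R^c) *: m s).
  move=> a h h'; rewrite scaler_sumr -big_split; apply: eq_bigr => s _.
  by rewrite dual_addE (dual_scaleE (a : R)) scalerDl scalerA.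
exists (mklin l) => h; rewrite [in RHS](dual_free_basis h) /= !linear_sum.
by apply: eq_bigr => s _; rewrite !linearZ /= mP.
Qed.

Lemma dual_free_fin_gen t : fin_gen (dual 'rV[R]_t).
Proof.
exists t, (@coordd t) => h.
by exists (fun s => dual_fun h (delta_mx 0 s)); exact: dual_free_basis.
Qed.

Lemma dual_fin_gen M : noetherian R^c -> fin_gen M -> fin_gen (dual M).
Proof.
move=> noe /fin_gen_free[t [p po]].
apply: (noe _ _ (dualm p)) (dual_free_fin_gen t) => f g.
move=> /(congr1 (@dual_fun R _)) fg; apply: dual_ext => x.
by have [y <-] := po x; have := congr1 (fun h => h y) fg.
Qed.

Lemma dual_st_retract M' M : fin_gen M' -> st_retract M' M ->
  st_retract (dual M') (dual M).
Proof.
move=> /fin_gen_free[t [q qo]] /(st_retract_cover qo)[u [v [b E]]].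
exists (dualm v), (dualm u), (dual 'rV[R]_t), (dualm q), (dualm b).
split=> [|f]; first exact: dual_free_projective.
apply: dual_ext => x; rewrite dual_addE /=.
by rewrite -[LHS]/(dual_lin f x) {1}(E x) linearD.
Qed.

(** * Reflexive modules *)

Definition torsionless M : Prop :=
  forall x : M, (forall f : dual M, dual_fun f x = 0) -> x = 0.

Definition all_evaluations M : Prop :=
  forall h : {linear dual M -> (R^c)^o}, exists x, forall f, h f = dual_fun f x.

Lemma reflexiveP M :
  bijective (@bidual R M) <-> torsionless M /\ all_evaluations M.
Proof.
split=> [[g gK Kg]|[tl ev]].
  split=> [x x0|h].
    apply: (can_inj gK); apply: dual_ext => f /=; rewrite x0.
    by rewrite dual_fun0.
  exists (g (lin_dual h)) => f.
  by rewrite -[RHS]/(dual_fun (bidual (g (lin_dual h))) f) Kg.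
have surj (w : dual (dual M)) : exists x, bidual x = w.
  have [x xE] := ev (dual_lin w); exists x; apply: dual_ext => f.
  by rewrite -[RHS]/(dual_lin w f) xE.
have [g gK] := choice surj; exists g => // x; apply/subr0_eq/tl => f.
rewrite -[LHS]/(dual_lin f _) linearB.
have := congr1 (fun w => dual_fun w f) (gK (bidual x)).
by rewrite /= => ->; rewrite subrr.
Qed.

Lemma free_all_evaluations t : all_evaluations 'rV[R]_t.
Proof.
move=> h; exists (\row_s (h (coordd s) : R)) => f.
rewrite [in LHS](dual_free_basis f) linear_sum.
rewrite {1}(row_basis (\row_s _)) -[RHS]/(dual_lin f _) linear_sum.
apply: eq_bigr => s _; rewrite !linearZ /= mxE.
by [].
Qed.

Lemma submodule_torsionless M t (i : {linear M -> 'rV[R]_t}) :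
  injective i -> torsionless M.
Proof.
move=> inj x x0; apply: inj; rewrite linear0; apply/rowP => s.
by have := x0 (dualm i (coordd s)); rewrite /= mxE => ->.
Qed.

Lemma free_reflexive t : bijective (@bidual R 'rV[R]_t).
Proof.
apply/reflexiveP; split; last exact: free_all_evaluations.
by apply: (@submodule_torsionless _ _ idfun) => x y.
Qed.

(** An evaluation [h] on the dual of [K] gives one on the dual of the free module,
    hence a vector [v]; functionals of [M] do not see [p v], so [v] lies in [K]. *)
Lemma syzygy_reflexive K t M (i : {linear K -> 'rV[R]_t})
    (p : {linear 'rV[R]_t -> M}) :
  ses i p -> extends i R^o -> torsionless M -> bijective (@bidual R K).
Proof.
move=> S ext tlM; have [inj ex po] := S.
apply/reflexiveP; split; first exact: (submodule_torsionless inj).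
move=> h; have [v vE] := free_all_evaluations (h \o dualm i).
have /ex[x xv] : p v = 0.
  apply: tlM => f; have := vE (dualm p f); rewrite /= => <-.
  have -> : dual_map i (dual_map p f) = 0; last exact: linear0.
  by apply: dual_ext => x; rewrite /= (ses_comp0 x S) dual_fun0.
exists x => f; have [g gE] := ext (dual_lin f).
have -> : f = dualm i (lin_dual g) by apply: dual_ext => y; rewrite /= gE.
by have := vE (lin_dual g); rewrite /= xv.
Qed.

(** This is the vanishing of the first extension group of the dual of [K]: a
    functional on the dual of [M] is evaluation at some [m], and evaluation at a
    preimage of [m] extends it. *)
Lemma reflexive_dual_extends K t M (i : {linear K -> 'rV[R]_t})
    (p : {linear 'rV[R]_t -> M}) :
  ses i p -> bijective (@bidual R M) -> extends (dualm p) (R^c)^o.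
Proof.
move=> [_ _ po] /reflexiveP[_ ev] h; have [m mE] := ev h.
have [v vm] := po m.
have l : linear (fun f : dual 'rV[R]_t => dual_fun f v : (R^c)^o).
  by move=> a f g; rewrite dual_addE (dual_scaleE (a : R)).
by exists (mklin l) => f; rewrite mE -vm.
Qed.

Lemma reflexive_st_retract M' M : fin_gen M' -> st_retract M' M ->
  bijective (@bidual R M) -> bijective (@bidual R M').
Proof.
move=> /fin_gen_free[t [q qo]] /(st_retract_cover qo)[u [v [b E]]].
move=> /reflexiveP[tl ev]; apply/reflexiveP; split=> [x x0|h].
  have u0 : u x = 0 by apply: tl => f; exact: (x0 (dualm u f)).
  have b0 : b x = 0.
    have /reflexiveP[tlF _] := free_reflexive t.
    by apply: tlF => f; exact: (x0 (dualm b f)).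
  by rewrite (E x) u0 b0 !linear0 addr0.
have [m mE] := ev (h \o dualm u).
have [w wE] := free_all_evaluations (h \o dualm b).
exists (v m + q w) => f; rewrite -[RHS]/(dual_lin f _) linearD /=.
have := mE (dualm v f); have := wE (dualm q f); rewrite /= => <- <-.
rewrite -linearD; congr (h _); apply: dual_ext => x.
by rewrite dual_addE /= -[LHS]/(dual_lin f x) {1}(E x) linearD.
Qed.

(** * Totally reflexive modules *)

Hypothesis noeR : noetherian R.
Hypothesis noeRc : noetherian R^c.

Lemma free_totally_reflexive t : totally_reflexive 'rV[R]_t.
Proof.
split=> [||[//|j] _|[//|j] _]; first exact: fin_gen_rV.
- exact: free_reflexive.
- apply: extv_Ext_vanishes => //; first exact: fin_gen_rV.
  exact/extv_projective/free_projective.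
- apply: extv_Ext_vanishes => //; first exact: dual_free_fin_gen.
  exact/extv_projective/dual_free_projective.
Qed.

Variables (X : resolution R) (n : nat).
Hypothesis extX : forall j, (n <= j)%N -> extends (rincl X j) R^o.

Lemma syz_reflexive i : (n < i)%N -> (1 < i)%N -> bijective (@bidual R (syz X i)).
Proof.
case: i => [//|[//|i]] ni _.
apply: (syzygy_reflexive (res_ses X i.+1)); first exact: extX.
by have [inj _ _] := res_ses X i; exact: (submodule_torsionless inj).
Qed.

(** Dualising reverses the resolution: the dual of a syzygy is a syzygy of the
    dual of the next one. Extension groups of degree [j.+1] thus come down to
    degree one, [j] steps earlier. *)
Lemma dual_syz_extv j i : (n.+1 < i)%N ->
  extv j (dual (syz X (j + i.+1))) (R^c)^o.
Proof.
move=> ni.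
have S l : (n <= l)%N -> ses (dualm (rproj X l)) (dualm (rincl X l)).
  by move=> nl; apply: dual_ses (res_ses X l) (extX nl).
elim: j => [|j IHj].
  exists (dual (syz X i)), (dual 'rV[R]_(rk X i)), (dualm (rproj X i)),
    (dualm (rincl X i)); split; last 1 first.
  - apply: (reflexive_dual_extends (res_ses X i)).
    by apply: syz_reflexive; [apply: ltn_trans ni|apply: leq_ltn_trans ni].
  - by apply: S; apply: leq_trans (ltnW ni).
  - exact: dual_free_projective.
exists (dual (syz X (j + i.+1))), (dual 'rV[R]_(rk X (j + i.+1))),
  (dualm (rproj X (j + i.+1))), (dualm (rincl X (j + i.+1))); split=> //.
  apply: S; apply: leq_trans (leq_addl _ _).
  by apply: leqW; apply: leq_trans (ltnW ni).
exact: dual_free_projective.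
Qed.

(** Far syzygies are reflexive, and their duals have no extensions by the ring
    up to a degree that grows with the distance from [n]. Recurrence carries both
    properties back to the [n]-th syzygy, in all degrees. *)
Lemma syz_totally_reflexive :
  (forall m, exists2 N, (m <= N)%N & st_retract (syz X n) (syz X (N + n))) ->
  totally_reflexive (syz X n).
Proof.
move=> rec; have fgn := syz_fin_gen X n; split=> //.
- have [N N2 r] := rec 2; apply: (reflexive_st_retract fgn r).
  apply: syz_reflexive.
    by rewrite -{1}[n]add0n ltn_add2r; apply: leq_trans N2.
  by apply: leq_trans N2 (leq_addr _ _).
- case=> // j _; apply: extv_Ext_vanishes => //.
  by apply: extv_of_res; apply: extX; exact: leq_addl.
case=> // j _; have fgd := dual_fin_gen noeRc fgn.
apply: extv_Ext_vanishes => //.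
(* The [j] steps of dimension shifting must end at a reflexive syzygy, and
   [dual_syz_extv] asks for one of index above [n.+1]. *)
have [N jN r] := rec (j + 3)%N.
have e : (N + n = j + ((N - (j + 3)) + n + 2).+1)%N.
  rewrite -[in LHS](subnK jN); move: (N - _)%N => q.
  by rewrite !addnS !addSn !addn0 [(q + j)%N]addnC addnA.
rewrite e in r; have := dual_st_retract fgn r.
move: (dual_syz_extv j (i := N - (j + 3) + n + 2)).
have [Y isoY] := resolution_exists noeRc fgd.
move=> ev rd; apply: (extv_iso isoY); apply: extv_of_res.
apply: (extv_res_st_retract (ev _)); first by rewrite addn2 !ltnS leq_addl.
exact: st_retract_trans (st_retract_iso isoY) rd.
Qed.

End FreeDuality.

(** * Resolutions by totally reflexive modules *)

Section Gresolutions.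
Variable R : pzRingType.
Implicit Types K M N P T : lmodType R.

Lemma Gres_step K T M (i : {linear K -> T}) (p : {linear T -> M}) n :
  ses i p -> totally_reflexive T -> has_Gresolution K n ->
  has_Gresolution M n.+1.
Proof.
move=> [inj ex po] tT [X [e [d [eo ex0 exd tX zX]]]].
pose X' j := if j is j'.+1 then X j' else T.
pose d' j : {linear X' j.+1 -> X' j} :=
  if j is j'.+1 as j0 return {linear X' j0.+1 -> X' j0} then d j' else i \o e.
exists X', p, d'; split=> //.
- move=> y; rewrite ex; split=> [[x <-]|[x <-]]; last by exists (e x).
  by have [z <-] := eo x; exists z.
- case=> [|j] /= y; last exact: exd.
  rewrite -ex0 /=; split=> [|->]; last exact: linear0.
  by rewrite -(linear0 i) => /inj.
- by case=> [|j] //= jn; exact: tX.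
- by case=> [|j] //= jn; exact: zX.
Qed.

Lemma Gres_0 M : totally_reflexive M -> has_Gresolution M 0.
Proof.
move=> tM; pose X j : lmodType R := if j is 0%N then M else 'rV[R]_0.
exists X, idfun, (fun j => \0).
have z j (y : X j.+1) : y = 0 by apply/rowP => -[].
split=> //.
- by move=> y; exists y.
- by move=> y /=; split=> [->|[x <-]] //; exists 0.
- by move=> j y; split=> // _; exists 0; rewrite [RHS]z.
- by case.
- by case=> // j _ y; exact: z.
Qed.

Lemma Gres_iso M M' n : module_iso M M' ->
  has_Gresolution M n -> has_Gresolution M' n.
Proof.
case=> f bf [X [e [d [eo ex0 exd tX zX]]]]; have [g [fK gK]] := bij_lin_inv bf.
exists X, (f \o e), d; split=> // [m|y].
  by have [x xE] := eo (g m); exists x; rewrite /= xE gK.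
by rewrite -ex0 /=; split=> [|->]; rewrite ?linear0 // -(linear0 f) => /(can_inj fK).
Qed.

Lemma Gres_of_syz (X : resolution R) n l :
  noetherian R -> noetherian R^c ->
  totally_reflexive (syz X (n + l)) -> has_Gresolution (syz X l) n.
Proof.
move=> noe noec; elim: n l => [|n IHn] l tX; first exact: Gres_0.
apply: (Gres_step (res_ses X l)); first exact: free_totally_reflexive.
by apply: IHn; rewrite -addSnnS.
Qed.

(** Totally reflexive modules have no extensions by the ring, so these can be
    shifted along the resolution up to its last term. *)
Lemma Gres_extv M n j : has_Gresolution M n -> (n <= j)%N -> extv j M R^o.
Proof.
elim: n j M => [|n IHn] j M [X [e [d [eo ex0 exd tX zX]]]] nj.
  have [_ _ ext _] := tX 0 (leqnn _).
  apply: (@extv_iso _ _ (X 0)); last exact/Ext_vanishes_extv/ext.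
  exists e; apply: inj_onto_bij => //; apply: injective0 => x /ex0[y <-].
  by rewrite (zX 1 isT y) linear0.
case: j nj => // j nj.
have [K [i S]] := ses_of_onto eo; have [inj exi _] := S.
have [x|p pE] := ses_factor_kernel (f := d 0) inj exi.
  by apply/ex0; exists x.
have [_ _ ext _] := tX 0 isT.
apply: (extv_shift S); first exact/Ext_vanishes_extv/ext.
apply: IHn nj; exists (fun m => X m.+1), p, (fun m => d m.+1); split=> //.
- move=> x; have [y yE] : exists y, d 0 y = i x by apply/ex0/(ses_comp0 x S).
  by exists y; apply: inj; rewrite pE.
- move=> y; split=> [py|[x <-]].
    by apply/exd; rewrite -pE py linear0.
  by apply: inj; rewrite pE linear0; apply/exd; exists x.
- by move=> m mn; exact: (tX m.+1).
- by move=> m mn; exact: (zX m.+1).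
Qed.

End Gresolutions.

(** * Modules up to injective summands *)

Section Injective.
Variable R : pzRingType.
Implicit Types C D I J K L M N P Q : lmodType R.

Definition factors_injective M N (f : {linear M -> N}) : Prop :=
  exists Q (b : {linear M -> Q}) (c : {linear Q -> N}),
    injective_module Q /\ forall x, f x = c (b x).

Definition inj_retract M' M : Prop :=
  exists (u : {linear M' -> M}) (v : {linear M -> M'}) Q
         (b : {linear M' -> Q}) (c : {linear Q -> M'}),
    injective_module Q /\ forall x, x = v (u x) + c (b x).

Lemma injective_of_retract M' M :
  inj_retract M' M -> injective_module M -> injective_module M'.
Proof.
move=> [u [v [Q [b [c [iQ E]]]]]] iM A B f g inj.
have [h hE] := iM A B f (u \o g) inj; have [k kE] := iQ A B f (b \o g) inj.
exists ((v \o h) \+ (c \o k)) => x /=.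
by rewrite hE kE /= -E.
Qed.

Lemma inj_retract_iso M' M : module_iso M' M -> inj_retract M' M.
Proof.
case=> f /bij_lin_inv[g [fK _]].
exists f, g, 'rV[R]_0, \0, \0; split; last by move=> x; rewrite fK /= addr0.
by move=> A B h k _; exists \0 => x; apply/rowP => -[].
Qed.

Lemma injective_of_factors M (f g : {linear M -> M}) :
  factors_injective f -> factors_injective g ->
  (forall x, x = f x + g x) -> injective_module M.
Proof.
move=> [Q [b [c [iQ fE]]]] [Q' [b' [c' [iQ' gE]]]] E.
apply: injective_of_retract iQ; exists b, c, Q', b', c'; split=> // x.
by rewrite -fE -gE.
Qed.

Lemma factors_injective_comp L M N P (e : {linear L -> M}) (f : {linear M -> N})
    (g : {linear N -> P}) :
  factors_injective f -> factors_injective (g \o (f \o e)).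
Proof.
move=> [Q [b [c [iQ E]]]]; exists Q, (b \o e), (g \o c); split=> // x.
by rewrite /= E.
Qed.

(** Cosyzygies are functorial up to injectives: the part of the middle map that
    comes from the factorisation of [a] can be subtracted, and the rest descends
    to the quotient [D]. *)
Lemma factors_injective_cosyzygy M I D (i : {linear M -> I}) (p : {linear I -> D})
    M' I' D' (i' : {linear M' -> I'}) (p' : {linear I' -> D'})
    (a : {linear M -> M'}) (b : {linear I -> I'}) (c : {linear D -> D'}) :
  ses i p -> ses i' p' -> injective_module I' ->
  (forall x, b (i x) = i' (a x)) -> (forall y, c (p y) = p' (b y)) ->
  factors_injective a -> factors_injective c.
Proof.
move=> S S' iI' ba cb [Q [u [v [iQ E]]]]; have [inj _ po] := S.
have [h hE] := iQ _ _ i u inj.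
have [x|s sE] := ses_factor_quotient (f := b \- (i' \o (v \o h))) S.
  by rewrite /= ba E hE subrr.
exists I', s, p'; split=> // d; have [y <-] := po d.
by rewrite cb sE /= linearB (ses_comp0 _ S') subr0.
Qed.

(** The dual of [st_retract_syzygy]. *)
Lemma inj_retract_cosyzygy M I D (i : {linear M -> I}) (p : {linear I -> D})
    M' I' D' (i' : {linear M' -> I'}) (p' : {linear I' -> D'}) :
  ses i p -> ses i' p' -> injective_module I -> injective_module I' ->
  inj_retract M' M -> inj_retract D' D.
Proof.
move=> S S' iI iI' [u [v [Q [b [c [iQ E]]]]]].
have [inj _ _] := S; have [inj' _ po'] := S'.
have [ut utE] := iI _ _ i' (i \o u) inj'; have [vt vtE] := iI' _ _ i (i' \o v) inj.
have [bt btE] := iQ _ _ i' b inj'.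
have [U UE] := ses_map_right S' S utE; have [V VE] := ses_map_right S S' vtE.
have [x|s sE] :=
    ses_factor_quotient (f := idfun \- ((vt \o ut) \+ (i' \o (c \o bt)))) S'.
  by rewrite /= utE /= vtE /= btE -linearD -linearB -E subrr linear0.
exists U, V, I', s, p'; split=> // d; have [y <-] := po' d.
rewrite UE VE sE /= linearB linearD (ses_comp0 _ S') addr0.
by rewrite addrC subrK.
Qed.

Lemma injective_split M I D (i : {linear M -> I}) (p : {linear I -> D}) :
  ses i p -> injective_module M ->
  exists s : {linear D -> I}, forall d, p (s d) = d.
Proof.
move=> S iM; have [inj _ _] := S.
have [r rE] := iM M I i idfun inj.
exact: ses_section_of_retraction S rE.
Qed.

Lemma injective_quotient M I D (i : {linear M -> I}) (p : {linear I -> D}) :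
  ses i p -> injective_module M -> injective_module I -> injective_module D.
Proof.
move=> S iM iI; have [s sE] := injective_split S iM.
apply: injective_of_retract iI; exists s, p, 'rV[R]_0, \0, \0.
split; last by move=> x; rewrite sE /= addr0.
by move=> A B h k _; exists \0 => x; apply/rowP => -[].
Qed.

(** * Injective resolutions *)

Lemma injres_step M I D (i : {linear M -> I}) (p : {linear I -> D}) n :
  ses i p -> injective_module I -> has_injective_resolution D n ->
  has_injective_resolution M n.+1.
Proof.
move=> [inj ex po] iI [J [e [d [ie ex0 exd iJ zJ]]]].
pose J' j := if j is j'.+1 then J j' else I.
pose d' j : {linear J' j -> J' j.+1} :=
  if j is j'.+1 as j0 return {linear J' j0 -> J' j0.+1} then d j' else e \o p.
exists J', i, d'; split=> //.
- move=> y; rewrite -ex /=; split=> [|->]; last exact: linear0.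
  by rewrite -(linear0 e) => /ie.
- case=> [|j] y; last exact: exd.
  rewrite ex0; split=> [[x <-]|[x <-]]; last by exists (p x).
  by have [z <-] := po x; exists z.
- by case=> [|j] //= jn; exact: iJ.
- by case=> [|j] //= jn; exact: zJ.
Qed.

Lemma injres_0 M : injective_module M -> has_injective_resolution M 0.
Proof.
move=> iM; pose J j : lmodType R := if j is 0%N then M else 'rV[R]_0.
exists J, idfun, (fun j => \0).
have z j (y : J j.+1) : y = 0 by apply/rowP => -[].
split=> //.
- by move=> y; split=> // _; exists y.
- by move=> j y; split=> // _; exists 0; rewrite [RHS]z.
- by case.
- by case=> // j _ y; exact: z.
Qed.

Lemma injres_iso M M' n : module_iso M M' ->
  has_injective_resolution M n -> has_injective_resolution M' n.
Proof.
case=> f bf [J [e [d [ie ex0 exd iJ zJ]]]]; have [g [fK gK]] := bij_lin_inv bf.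
exists J, (e \o g), d; split=> // [|y]; first exact: inj_comp (can_inj gK).
rewrite ex0; split=> [[x <-]|[x <-]]; last by exists (g x).
by exists (f x); rewrite /= fK.
Qed.

Variables (C J : nat -> lmodType R) (i : forall j, {linear C j -> J j})
  (p : forall j, {linear J j -> C j.+1}).
Hypothesis S : forall j, ses (i j) (p j).
Hypothesis iJ : forall j, injective_module (J j).

(** Two injective resolutions of a module have the same cosyzygies up to
    injective summands, so any of them detects the injective dimension. *)
Lemma injres_cosyzygy n :
  has_injective_resolution (C 0) n <-> injective_module (C n).
Proof.
split; last first.
  rewrite -{1}(addn0 n); move: 0%N => l.
  elim: n l => [|n IHn] l iC; first exact: injres_0.
  by apply: (injres_step (S l) (@iJ l)); apply: IHn; rewrite -addSnnS.
suff H m l M : has_injective_resolution M m -> inj_retract (C l) M ->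
    injective_module (C (m + l)).
  move=> h; rewrite -(addn0 n); apply: H h _; apply: inj_retract_iso.
  by exists idfun; exists idfun.
elim: m l M => [|m IHm] l M [I [e [d [ie ex0 exd iI zI]]]] r.
  apply: injective_of_retract r _; apply: injective_of_retract (iI 0 isT).
  apply: inj_retract_iso; exists e; apply: inj_onto_bij => // y.
  by apply/ex0; exact: zI.
have [D [q [k [qo ik kE]]]] := im_exists (d 0).
have SM : ses e q.
  split=> // y; rewrite -ex0 -kE; split=> [->|]; first exact: linear0.
  by rewrite -(linear0 k) => /ik.
rewrite addSnnS; apply: (IHm _ D); last first.
  exact: inj_retract_cosyzygy SM (S l) (iI 0 isT) (@iJ l) r.
exists (fun m => I m.+1), k, (fun m => d m.+1); split=> //.
- move=> y; rewrite exd; split=> [[x <-]|[x <-]].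
    by exists (q x).
  by have [z <-] := qo x; exists z.
- by move=> j jm; exact: (iI j.+1).
- by move=> j jm; exact: (zI j.+1).
Qed.

End Injective.

(** * Restriction of scalars, vector spaces and finite dimensional rings *)

Definition restr (R T : pzRingType) (f : {rmorphism R -> T}) (X : lmodType T) :
  Type := X.

Section Restriction.
Variables (R T : pzRingType) (f : {rmorphism R -> T}) (X : lmodType T).

HB.instance Definition _ := GRing.Zmodule.on (restr f X).

Definition restr_scale (a : R) (x : restr f X) : restr f X := f a *: (x : X).

Lemma restr_scaleA a b x :
  restr_scale a (restr_scale b x) = restr_scale (a * b) x.
Proof. by rewrite /restr_scale scalerA rmorphM. Qed.

Lemma restr_scale1 : left_id 1 restr_scale.
Proof. by move=> x; rewrite /restr_scale rmorph1 scale1r. Qed.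

Lemma restr_scaleDr : right_distributive restr_scale +%R.
Proof. by move=> a x y; rewrite /restr_scale scalerDr. Qed.

Lemma restr_scaleDl x : {morph restr_scale^~ x : a b / a + b}.
Proof. by move=> a b; rewrite /restr_scale rmorphD scalerDl. Qed.

HB.instance Definition _ := GRing.Zmodule_isLmodule.Build R (restr f X)
  restr_scaleA restr_scale1 restr_scaleDr restr_scaleDl.

Lemma restr_scaleE (a : R) (x : X) : a *: (x : restr f X) = f a *: x.
Proof. by []. Qed.

End Restriction.

Section RestrictionMaps.
Variables (R T : pzRingType) (f : {rmorphism R -> T}) (X Y : lmodType T).

Lemma restr_linear (g : {linear X -> Y}) : linear (g : restr f X -> restr f Y).
Proof. by move=> a x y; rewrite !restr_scaleE -linearP. Qed.

Definition restr_map (g : {linear X -> Y}) : {linear restr f X -> restr f Y} :=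
  mklin (restr_linear g).

End RestrictionMaps.

Lemma restr_ses (R T : pzRingType) (f : {rmorphism R -> T}) (K P M : lmodType T)
    (i : {linear K -> P}) (p : {linear P -> M}) :
  ses i p -> ses (restr_map f i) (restr_map f p).
Proof. by []. Qed.

(** By Zorn's lemma there is a maximal partial extension, and a partial extension
    that misses a vector can be enlarged. *)
Lemma vspace_injective (k : fieldType) (V : lmodType k) : injective_module V.
Proof.
move=> M N f g inj.
(* The empty relation is admitted, being the union of the empty chain: hence the
   condition in the last clause. *)
pose P (G : set (N * V)) :=
  [/\ forall a x x' y y', G (x, y) -> G (x', y') -> G (a *: x + x', a *: y + y'),
      forall y, G (0, y) -> y = 0 & forall z, G z -> forall x, G (f x, g x)].
have PG : P (fun z => exists x, (f x, g x) = z).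
  split=> [a _ _ _ _ [x [<- <-]] [x' [<- <-]]|y [x [fx <-]]|z _ x].
  - by exists (a *: x + x'); rewrite !linearP.
  - by rewrite (inj x 0) ?linear0.
  - by exists x.
have [F FP tot|A [[lA fA gA] maxA]] := @Zorn_bigcup _ P.
  have sup X Y : F X -> F Y -> exists2 Z, F Z & (X `<=` Z /\ Y `<=` Z)%classic.
    move=> FX FY; case: (tot X Y FX FY) => XY; first by exists Y => //; split.
    by exists X => //; split.
  split=> [a x x' y y' [X FX Xz] [Y FY Yz]|y [X FX Xy]|z [X FX Xz] x].
  - have [Z FZ [XZ YZ]] := sup _ _ FX FY; exists Z => //.
    by have [l _ _] := FP _ FZ; apply: l; [exact: XZ|exact: YZ].
  - by have [_ u _] := FP _ FX; exact: u.
  - by have [_ _ c] := FP _ FX; exists X => //; exact: c Xz x.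
have A0 : A (0, 0).
  apply: contrapT => nA; apply: (maxA _ _ PG); split=> [z Az|sub].
    by case: nA; have := gA z Az 0; rewrite !linear0.
  by apply: nA; apply: sub; exists 0; rewrite !linear0.
have gA' := gA _ A0.
have totA x0 : exists y, A (x0, y).
  apply: contrapT => nx0.
  apply: (maxA (fun z => exists a, A (z.1 - a *: x0, z.2))); split.
  - move=> z Az; exists 0; rewrite scale0r subr0; by case: z Az.
  - move=> /(_ (x0, 0)) sub; apply: nx0; exists 0; apply: sub => /=.
    by exists 1; rewrite scale1r subrr.
  - move=> a x x' y y' [b /= Ab] [c /= Ac]; exists (a * b + c) => /=.
    have := lA a _ _ _ _ Ab Ac; congr (A (_, _)).
    by rewrite scalerBr scalerA addrACA -opprD -scalerDl.
  - move=> y [a /= Aa]; case: (eqVneq a 0) Aa => [->|a0 Aa].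
      by rewrite scale0r subr0; exact: fA.
    case: nx0; exists (- a^-1 *: y).
    have := lA (- a^-1) _ _ _ _ Aa A0; rewrite !addr0 sub0r.
    by rewrite scalerN scaleNr opprK scalerA mulVf // scale1r.
  - move=> z _ x; exists 0; rewrite scale0r subr0; exact: gA'.
have [||h hE] := linear_of_graph totA.
- by move=> a x x' y y'; exact: lA.
- exact: fA.
exists h => x; apply/subr0_eq/fA.
have := lA (-1) _ _ _ _ (gA' x) (hE (f x)).
by rewrite !scaleN1r addNr addrC.
Qed.

(** A subspace of maximal dimension inside [S] is all of [S]. *)
Lemma subspace_vspace (k : fieldType) (V : vectType k) (S : V -> Prop) : S 0 ->
  (forall a x y, S x -> S y -> S (a *: x + y)) ->
  exists U : {vspace V}, forall v, S v <-> v \in U.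
Proof.
move=> S0 SP; pose D d := `[<exists2 U : {vspace V}, \dim U = d & forall v, v \in U -> S v>].
have exD : exists d, D d.
  by exists 0; apply/asboolP; exists 0%VS; [exact: dimv0 | move=> v /[!memv0]/eqP->].
have bD d : D d -> (d <= \dim {:V})%N.
  by move=> /asboolP[U <- _]; exact/dimvS/subvf.
have [d /asboolP[U dU US] maxd] := ex_maxnP exD bD.
exists U => v; split=> [Sv|]; last exact: US.
have : (\dim (U + <[v]>) <= \dim U)%N.
  rewrite dU; apply: maxd; apply/asboolP; exists (U + <[v]>)%VS => //.
  move=> w /memv_addP[u Uu [_ /vlineP[a ->] ->]].
  by rewrite addrC; apply: SP => //; exact: US.
move=> dimle; have /eqP <- : (U + <[v]> == U)%VS.
  by rewrite eq_sym eqEdim addvSl.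
exact: (subvP (addvSr U <[v]>)) (memv_line v).
Qed.

(** Generators of a submodule are read off a basis of the subspace that
    corresponds to it in a finite dimensional space of coordinates. *)
Lemma finite_dim_noetherian (k : fieldType) (R : pzRingType)
    (phi : {rmorphism k -> R}) (J : finType) (e : J -> R) :
  (forall x, exists c : J -> k, x = \sum_p phi (c p) * e p) -> noetherian R.
Proof.
move=> span M N i inj [t [n nP]].
pose F (A : 'M[k]_(t, #|J|)) : restr phi N :=
  \sum_s \sum_p phi (A s (enum_rank p)) *: (e p *: n s).
have lF : linear F.
  move=> a A B; rewrite /F restr_scaleE scaler_sumr -big_split.
  apply: eq_bigr => s _; rewrite scaler_sumr -big_split.
  by apply: eq_bigr => p _; rewrite !mxE rmorphD rmorphM scalerDl !scalerA.
have onF x : exists A, F A = x.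
  have [c ->] := nP x; have [d dE] := choice (fun s => span (c s)).
  exists (\matrix_(s, p) d s (enum_val p)); apply: eq_bigr => s _.
  rewrite [in RHS]dE scaler_suml; apply: eq_bigr => p _.
  by rewrite mxE enum_rankK scalerA.
have [||U UP] := @subspace_vspace k 'M[k]_(t, #|J|) (fun A => exists x, i x = F A).
- by exists 0; rewrite linear0 -(linear0 (mklin lF)).
- move=> a A B [x xE] [y yE]; exists (phi a *: x + y).
  by rewrite lF linearP xE yE.
have mP (j : 'I_(\dim U)) : exists x, i x = F (vbasis U)`_j.
  by apply/UP/vbasis_mem/mem_nth; rewrite size_tuple.
have [m mE] := choice mP.
exists (\dim U), m => x; have [A FA] := onF (i x).
have /UP AU : exists x, i x = F A by exists x.
exists (fun j => phi (coord (vbasis U) j A)); apply: inj.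
rewrite -FA [in LHS](coord_vbasis AU) -[LHS]/(mklin lF _) !linear_sum.
by apply: eq_bigr => j _; rewrite !linearZ /= restr_scaleE mE.
Qed.

(** * Enveloping algebras from one side *)

(** [E] plays the enveloping algebra of [S], with its left action [lam] and its
    right action [rho]; it is free as a left module over [S] on the elements
    [rho (bas p)], with coordinates [kap p]. Since the enveloping algebra of an
    algebra is also that of its converse, with the two actions exchanged, this
    presentation lets the same argument bound the injective dimensions on both
    sides. *)
Record enveloping (k : fieldType) (S E : pzRingType) := Enveloping {
  scal : {rmorphism k -> S};
  lam : {rmorphism S -> E};
  rho : S -> E;
  dimS : nat;
  bas : 'I_dimS -> S;
  cfun : 'I_dimS -> S -> k;
  kap : 'I_dimS -> E -> S;
  scalC : forall c s, scal c * s = s * scal c;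
  bas_sum : forall s, s = \sum_p scal (cfun p s) * bas p;
  rhoD : {morph rho : a b / a + b};
  rho1 : rho 1 = 1;
  rhoM : forall a b, rho (a * b) = rho b * rho a;
  lam_rho : forall a b, lam a * rho b = rho b * lam a;
  rho_scal : forall c, rho (scal c) = lam (scal c);
  kap_sum : forall z, z = \sum_p lam (kap p z) * rho (bas p);
  kapD : forall p, {morph kap p : y z / y + z};
  kap_lam : forall p a z, kap p (lam a * z) = a * kap p z;
  kap_rho : forall p b, kap p (rho b) = scal (cfun p b) }.

Section Enveloping.
Variables (k : fieldType) (S E : pzRingType) (en : enveloping k S E).
Implicit Types (X Y K P M : lmodType E).

Local Notation lam := (lam en).
Local Notation rho := (rho en).
Local Notation scal := (scal en).
Local Notation bas := (bas (e := en)).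
Local Notation kap := (kap (e := en)).
Local Notation cfun := (cfun (e := en)).
Local Notation res := (restr lam).

Lemma rho0 : rho 0 = 0.
Proof. by apply: (@addrI _ (rho 0)); rewrite -rhoD !addr0. Qed.

Lemma kap0 p : kap p 0 = 0.
Proof. by apply: (@addrI _ (kap p 0)); rewrite -kapD !addr0. Qed.

Lemma rho_sumr I (r : seq I) (F : I -> S) :
  rho (\sum_(i <- r) F i) = \sum_(i <- r) rho (F i).
Proof. by apply: big_morph; [exact: rhoD | exact: rho0]. Qed.

Lemma kap_sumr p I (r : seq I) (F : I -> E) :
  kap p (\sum_(i <- r) F i) = \sum_(i <- r) kap p (F i).
Proof. by apply: big_morph; [exact: kapD | exact: kap0]. Qed.

Lemma rho_bas_sum b : rho b = \sum_p lam (scal (cfun p b)) * rho (bas p).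
Proof.
by rewrite {1}(bas_sum en b) rho_sumr; apply: eq_bigr => p _;
  rewrite rhoM rho_scal lam_rho.
Qed.

Lemma kap_rhoM p b z :
  kap p (rho b * z) = \sum_q scal (cfun p (bas q * b)) * kap q z.
Proof.
rewrite {1}(kap_sum en z) mulr_sumr kap_sumr; apply: eq_bigr => q _.
by rewrite mulrA -lam_rho -mulrA -rhoM kap_lam kap_rho scalC.
Qed.

Lemma enveloping_linear X Y (f : X -> Y) : {morph f : x y / x + y} ->
  (forall a x, f (lam a *: x) = lam a *: f x) ->
  (forall b x, f (rho b *: x) = rho b *: f x) -> linear f.
Proof.
move=> fD fl fr a x y; rewrite fD; congr (_ + _).
have f0 : f 0 = 0 by apply: (@addrI _ (f 0)); rewrite -fD !addr0.
rewrite (kap_sum en a) !scaler_suml (big_morph f fD f0).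
by apply: eq_bigr => p _; rewrite -!scalerA fl fr.
Qed.

(** * Homomorphisms into the base ring *)

(** For an [E]-module [X], [homS X] is the module of maps into [S] that are linear
    for the left action; the right action of [S] on [X] makes it an [S]-module.
    Applied to a projective resolution of the regular bimodule it yields an
    injective resolution of [S]. *)
Definition homS_pred X : {pred X -> S^o} :=
  fun f => `[<linear (f : res X -> S^o)>].
Arguments homS_pred X _ : clear implicits.

Lemma homS_zmod_closed X : zmod_closed (homS_pred X).
Proof.
split=> [|f g /asboolP lf /asboolP lg]; apply/asboolP => a x y.
  by rewrite /= scaler0 addr0.
rewrite -![(f - g) _]/(f _ - g _) lf lg scalerBr opprD addrACA.
by [].
Qed.

HB.instance Definition _ X :=
  GRing.isZmodClosed.Build _ (homS_pred X) (homS_zmod_closed X).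

Record homS X := HomS { homS_fun : X -> S^o; homS_subproof : homS_fun \in homS_pred X }.

HB.instance Definition _ X := [isSub for @homS_fun X].
HB.instance Definition _ X := [Choice of homS X by <:].
HB.instance Definition _ X := [SubChoice_isSubZmodule of homS X by <:].

Lemma homS_linear X (f : homS X) : linear (homS_fun f : res X -> S^o).
Proof. exact/asboolP/(homS_subproof f). Qed.

Definition homS_lin X (f : homS X) : {linear res X -> S^o} := mklin (homS_linear f).

Definition lin_homS X (g : {linear res X -> S^o}) : homS X :=
  @HomS X (g : X -> S^o) (asboolT (linearP g)).

Lemma homS_ext X (f g : homS X) : (forall x, homS_fun f x = homS_fun g x) -> f = g.
Proof. by move=> fg; apply/val_inj/funext. Qed.

Lemma homS_scale_subproof X b (f : homS X) :
  linear (fun x : res X => homS_fun f (rho b *: (x : X))).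
Proof.
move=> a x y; rewrite -homS_linear restr_scaleE; congr (homS_fun f _).
by rewrite scalerDr restr_scaleE !scalerA lam_rho.
Qed.

Definition homS_scale X b (f : homS X) : homS X :=
  lin_homS (mklin (homS_scale_subproof b f)).

Lemma homS_addE X (f g : homS X) x :
  homS_fun (f + g) x = homS_fun f x + homS_fun g x.
Proof. by []. Qed.

Fact homS_scaleA X a b (f : homS X) :
  homS_scale a (homS_scale b f) = homS_scale (a * b) f.
Proof. by apply: homS_ext => x; rewrite /= scalerA rhoM. Qed.

Fact homS_scale1 X : left_id 1 (@homS_scale X).
Proof. by move=> f; apply: homS_ext => x; rewrite /= rho1 scale1r. Qed.

Fact homS_scaleDr X : right_distributive (@homS_scale X) +%R.
Proof. by move=> a f g; apply: homS_ext. Qed.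

Fact homS_scaleDl X (f : homS X) : {morph (@homS_scale X)^~ f : a b / a + b}.
Proof.
move=> a b; apply: homS_ext => x; rewrite homS_addE /= rhoD scalerDl.
exact: (linearD (homS_lin f)).
Qed.

HB.instance Definition _ X := GRing.Zmodule_isLmodule.Build S (homS X)
  (@homS_scaleA X) (@homS_scale1 X) (@homS_scaleDr X) (@homS_scaleDl X).

Lemma homS_scaleE X b (f : homS X) x :
  homS_fun (b *: f) x = homS_fun f (rho b *: x).
Proof. by []. Qed.

Lemma homS_lamE X (f : homS X) a x : homS_fun f (lam a *: x) = a * homS_fun f x.
Proof. exact: (linearZ_LR (homS_lin f)). Qed.

Lemma homS_funD X (f : homS X) x y :
  homS_fun f (x + y) = homS_fun f x + homS_fun f y.
Proof. exact: (linearD (homS_lin f)). Qed.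

Lemma homS_fun0 X (f : homS X) : homS_fun f 0 = 0.
Proof. exact: (linear0 (homS_lin f)). Qed.

Definition homS_map X Y (h : {linear X -> Y}) (f : homS Y) : homS X :=
  lin_homS (homS_lin f \o restr_map lam h).

Lemma homS_map_linear X Y (h : {linear X -> Y}) : linear (homS_map h).
Proof.
move=> a f g; apply: homS_ext => x.
by rewrite homS_addE homS_scaleE /= linearZ.
Qed.

Definition homSm X Y (h : {linear X -> Y}) : {linear homS Y -> homS X} :=
  mklin (homS_map_linear h).

Lemma homSmE X Y (h : {linear X -> Y}) f x : homS_fun (homSm h f) x = homS_fun f (h x).
Proof. by []. Qed.

Lemma homS_ses K P M (i : {linear K -> P}) (p : {linear P -> M}) :
  ses i p -> projective_module (res M) -> ses (homSm p) (homSm i).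
Proof.
move=> s pM; have [_ _ po] := s; split.
- move=> f g /(congr1 (@homS_fun _)) fg; apply: homS_ext => x.
  by have [y <-] := po x; exact: (congr1 (fun h => h y) fg).
- move=> g; split=> [/(congr1 (@homS_fun _)) gi0|[h <-]]; last first.
    by apply: homS_ext => x; rewrite !homSmE (ses_comp0 x s) homS_fun0.
  have [x|h hE] := ses_factor_quotient (f := homS_lin g) (restr_ses lam s).
    exact: (congr1 (fun h => h x) gi0).
  by exists (lin_homS h); apply: homS_ext => y; exact: hE.
- move=> g; have [t tE] := pM _ _ (restr_map lam p) idfun po.
  have [r rE] := ses_retraction_of_section (restr_ses lam s) tE.
  by exists (lin_homS (homS_lin g \o r)); apply: homS_ext => x /=; rewrite rE.
Qed.

Lemma syzygy_res_projective K P M (i : {linear K -> P}) (p : {linear P -> M}) :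
  ses i p -> projective_module (res P) -> projective_module (res M) ->
  projective_module (res K).
Proof.
move=> s pP pM; have [_ _ po] := s.
have [t tE] := pM _ _ (restr_map lam p) idfun po.
have [r rE] := ses_retraction_of_section (restr_ses lam s) tE.
move=> A B f g fo; have [h hE] := pP A B f (g \o r) fo.
by exists (h \o restr_map lam i) => x; rewrite /= hE /= rE.
Qed.

Lemma free_res_projective t : projective_module (res 'rV[E]_t).
Proof.
move=> A B f g fo.
have [m mP] := choice (fun sp : 'I_t * 'I_(dimS en) =>
  fo (g (rho (bas sp.2) *: delta_mx 0 sp.1))).
have l : linear (fun v : res 'rV[E]_t => \sum_s \sum_p kap p (v 0 s) *: m (s, p)).
  move=> a v w; rewrite scaler_sumr -big_split; apply: eq_bigr => s _.
  rewrite scaler_sumr -big_split; apply: eq_bigr => p _ /=.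
  by rewrite restr_scaleE !mxE kapD kap_lam scalerDl scalerA.
exists (mklin l) => v /=.
have e : v = \sum_s \sum_p (kap p (v 0 s) *: (rho (bas p) *: delta_mx 0 s : res _)).
  rewrite {1}(row_basis v); apply: eq_bigr => s _.
  rewrite {1}(kap_sum en (v 0 s)) scaler_suml; apply: eq_bigr => p _.
  by rewrite restr_scaleE scalerA.
rewrite [in RHS]e !linear_sum; apply: eq_bigr => s _.
rewrite !linear_sum; apply: eq_bigr => p _.
by rewrite !linearZ mP.
Qed.

(** A map into [homS] of a free module amounts to linear maps into [S] over the
    base field, one for each basis vector: such modules are coinduced from vector
    spaces, and linear maps of vector spaces extend. *)
Lemma homS_free_injective t : injective_module (homS 'rV[E]_t).
Proof.
move=> M N f g inj.
have l (s : 'I_t) : linear (fun m : restr scal M =>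
    homS_fun (g m) (delta_mx 0 s) : restr scal S^o).
  move=> a x y; rewrite !restr_scaleE linearP homS_addE homS_scaleE rho_scal.
  by rewrite homS_lamE.
have ext s := @vspace_injective k _ _ _ (restr_map scal f) (mklin (l s)) inj.
have [G GE] := choice ext.
have Gscal s c n : G s (scal c *: (n : N)) = scal c * (G s n : S).
  exact: (linearZ_LR (G s) c n).
pose h (n : N) (v : 'rV[E]_t) : S := \sum_s \sum_p kap p (v 0 s) * (G s (bas p *: n) : S).
have lh n : linear (h n : res 'rV[E]_t -> S^o).
  move=> a v w; rewrite restr_scaleE scaler_sumr -big_split; apply: eq_bigr => s _.
  rewrite scaler_sumr -big_split; apply: eq_bigr => p _ /=.
  by rewrite !mxE kapD kap_lam mulrDl -mulrA.
have lH : linear (fun n => lin_homS (mklin (lh n))).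
  move=> a n n'; apply: homS_ext => v; rewrite homS_addE homS_scaleE /=.
  rewrite /h -big_split; apply: eq_bigr => s _ /=.
  transitivity (\sum_p kap p (v 0 s) * (G s (bas p *: (a *: n)) : S) +
      \sum_p kap p (v 0 s) * (G s (bas p *: n') : S)).
    rewrite -big_split; apply: eq_bigr => p _ /=.
    by rewrite scalerDr linearD mulrDr.
  congr (_ + _); rewrite mxE.
  transitivity (\sum_p \sum_q kap p (v 0 s) *
      (scal (cfun q (bas p * a)) * (G s (bas q *: n) : S))).
    apply: eq_bigr => p _; rewrite -mulr_sumr scalerA; congr (_ * _).
    rewrite {1}(bas_sum en (bas p * a)) scaler_suml linear_sum.
    by apply: eq_bigr => q _; rewrite -scalerA Gscal.
  rewrite exchange_big; apply: eq_bigr => q _ /=.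
  rewrite kap_rhoM mulr_suml; apply: eq_bigr => p _.
  by rewrite mulrA -scalC.
exists (mklin lH) => m; apply: homS_ext => v.
rewrite /= /h [in RHS](row_basis v) (big_morph _ (homS_funD (g m)) (homS_fun0 (g m))).
apply: eq_bigr => s _; rewrite {2}(kap_sum en (v 0 s)) scaler_suml.
rewrite (big_morph _ (homS_funD (g m)) (homS_fun0 (g m))); apply: eq_bigr => p _.
rewrite -scalerA homS_lamE; congr (_ * _).
by rewrite -homS_scaleE -!linearZ /=; exact: GE.
Qed.

(** * The injective resolution given by the regular bimodule *)

Variables (B : lmodType E) (b0 : B).
Hypothesis b0C : forall s, lam s *: b0 = rho s *: b0.
Hypothesis b0_bij : bijective (fun s => lam s *: b0).

Lemma regular_res_projective : projective_module (res B).
Proof.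
have [be beK Kbe] := b0_bij.
move=> P Q f g fo; have [m mP] := fo (g b0).
have l : linear (fun y : res B => be y *: m).
  move=> a x y; rewrite scalerA -scalerDl; congr (_ *: _).
  apply: (can_inj beK); rewrite Kbe rmorphD rmorphM scalerDl -scalerA !Kbe.
  by [].
exists (mklin l) => y; rewrite /= linearZ mP -linearZ_LR restr_scaleE.
by rewrite Kbe.
Qed.

Lemma homS_regular : module_iso (homS B) S^o.
Proof.
have [be beK Kbe] := b0_bij.
have l : linear (fun f : homS B => homS_fun f b0).
  by move=> a f g; rewrite homS_addE homS_scaleE -b0C homS_lamE.
exists (mklin l); apply: inj_onto_bij => [f g /= fg|s].
  by apply: homS_ext => y; rewrite -(Kbe y) !homS_lamE fg.
have l' : linear (fun y : res B => be y * s : S^o).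
  move=> a x y; rewrite /GRing.scale /= mulrA -mulrDl; congr (_ * _).
  apply: (can_inj beK); rewrite Kbe rmorphD rmorphM scalerDl -scalerA !Kbe.
  by [].
exists (lin_homS (mklin l')) => /=; have -> : be b0 = 1; last by rewrite mul1r.
by apply: (can_inj beK); rewrite Kbe rmorph1 scale1r.
Qed.

Lemma homS_regular_projective : projective_module (homS B).
Proof.
have [f /bij_lin_inv[g [fK gK]]] := homS_regular.
move=> P Q q h qo; have [m mP] := qo (h (g 1)).
have l : linear (fun x => (f x : S) *: m).
  by move=> a x y; rewrite linearP scalerDl -scalerA.
exists (mklin l) => x; rewrite /= linearZ mP -!linearZ; congr (h _).
by apply: (can_inj fK); rewrite gK /GRing.scale /= mulr1.
Qed.

Variable X : resolution E.
Hypothesis isoX : module_iso (syz X 0) B.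

(** Over [S] the resolution splits, starting from [B] which is free. *)
Lemma syz_res_projective j : projective_module (res (syz X j)).
Proof.
elim: j => [|j IHj].
  have [f /bij_lin_inv[g [fK gK]]] := isoX.
  move=> P Q q h qo.
  have [d dE] := regular_res_projective (h \o restr_map lam g) qo.
  by exists (d \o restr_map lam f) => x; rewrite /= dE /= fK.
exact: (syzygy_res_projective (res_ses X j) (@free_res_projective _) IHj).
Qed.

Definition cosyz_ses j := homS_ses (res_ses X j) (@syz_res_projective j).

Lemma injres_regular n :
  has_injective_resolution S^o n <-> injective_module (homS (syz X n)).
Proof.
rewrite -(injres_cosyzygy cosyz_ses (fun j => @homS_free_injective _) n).
have i0 : module_iso (homS (syz X 0)) S^o.
  have [f /bij_lin_inv[g [fK gK]]] := isoX; have [h bh] := homS_regular.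
  exists (h \o homSm g); apply: (bij_comp bh).
  exists (homSm f) => u; apply: homS_ext => x; rewrite !homSmE.
    by rewrite fK.
  by rewrite gK.
split; last exact: injres_iso.
by apply: injres_iso; have [f /bij_lin_inv[g [fK gK]]] := i0; exists g; exists f.
Qed.

End Enveloping.

(** * Extensions by the enveloping algebra and injective dimension *)

Section Transfer.
Variables (k : fieldType) (S E : pzRingType) (en : enveloping k S E).
Variables (B : lmodType E) (b0 : B).
Hypothesis b0C : forall s, lam en s *: b0 = rho en s *: b0.
Hypothesis b0_bij : bijective (fun s => lam en s *: b0).
Variable X : resolution E.
Hypothesis isoX : module_iso (syz X 0) B.

Local Notation H := (homSm en).
Local Notation bas := (bas (e := en)).
Local Notation kap := (kap (e := en)).
Local Notation cfun := (cfun (e := en)).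
Let cosyz j := cosyz_ses b0_bij isoX j.

(** Such a [v] comes from an extension class of [B] by itself, of positive degree
    [N]. On the injective resolution of [S] this class induces an extension class
    of [S] by itself, which is zero since [S] is projective. At the bottom of the
    induction this reads: a map from [homS] of [B], a free module, lifts to an
    injective term of the resolution. *)
Lemma homS_map_factors n N m (v : {linear syz X (m + N) -> syz X m}) :
  (forall j, (n <= j)%N -> extends (rincl X j) E^o) -> (n <= N)%N -> (0 < N)%N ->
  factors_injective (H v).
Proof.
move=> ext nN N0; elim: m v => [|m IHm] v.
  case: N N0 nN v => // N _ _ v.
  have pH0 : projective_module (homS en (syz X 0)).
    have [f /bij_lin_inv[g [fK gK]]] := isoX.
    move=> P Q q h qo.
    have [d dE] := homS_regular_projective b0C b0_bij (h \o H f) qo.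
    exists (d \o H g) => u /=; rewrite dE /=; congr (h _); apply: homS_ext => x.
    by rewrite -[LHS]/(homS_fun u (g (f x))) fK.
  have [_ _ po] := cosyz N; have [h hE] := pH0 _ _ _ (H v) po.
  exists (homS en 'rV[E]_(rk X N)), h, (H (rincl X N)).
  by split; [exact: homS_free_injective | move=> x; rewrite hE].
(* The absence of extensions beyond degree [n] lets [v] descend one step. *)
have nmN : (n <= m + N)%N := leq_trans nN (leq_addl _ _).
have [w wE] := extends_free (ext _ nmN) (rincl X m \o v).
have [v' v'E] := ses_map_right (res_ses X (m + N)) (res_ses X m) wE.
apply: (factors_injective_cosyzygy (cosyz m) (cosyz (m + N)) (a := H v') (b := H w)).
- exact: homS_free_injective.
- by move=> f; apply: homS_ext => x; rewrite !homSmE v'E.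
- by move=> f; apply: homS_ext => x; rewrite !homSmE wE.
- exact: IHm.
Qed.

(** Recurrence makes the identity of the [n]-th syzygy a composite through a map
    of the kind treated above, up to projectives. *)
Lemma ext_cosyz_injective n :
  (forall j, (n <= j)%N -> extends (rincl X j) E^o) ->
  (forall a, exists2 N, (a <= N)%N & st_retract (syz X n) (syz X (N + n))) ->
  injective_module (homS en (syz X n)).
Proof.
move=> ext rec; have [N + r] := rec (maxn n 1); rewrite geq_max => /andP[nN N0].
rewrite addnC in r; have [_ _ po] := res_ses X n.
have [u [v [b E0]]] := st_retract_cover po r.
have fv := homS_map_factors v ext nN N0.
apply: (injective_of_factors (f := H u \o (H v \o idfun)) (g := H b \o H (rproj X n))).
- exact: factors_injective_comp fv.
- exists (homS en 'rV[E]_(rk X n)), (H (rproj X n)), (H b).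
  by split=> //; exact: homS_free_injective.
by move=> f; apply: homS_ext => x; rewrite homS_addE /= -homS_funD -E0.
Qed.

(** Through the coordinates [kap p], an [E]-linear map into [E] becomes a family of
    elements of [homS]. A section of the restriction map, which exists as the
    cosyzygy is injective, extends each of them; linearity for the right action
    survives because the section is linear over [S]. *)
Lemma cosyz_injective_ext n j : injective_module (homS en (syz X n)) ->
  (n <= j)%N -> extends (rincl X j) E^o.
Proof.
move=> iC nj f.
have {nj} iCj : injective_module (homS en (syz X j)).
  rewrite -(subnK nj); elim: (j - n)%N => //= d IHd.
  exact: (injective_quotient (cosyz (d + n)) IHd (@homS_free_injective _ _ _ en _)).
have [s sE] := injective_split (cosyz j) iCj.
have scalE Y c (h : homS en Y) y :
    homS_fun (scal en c *: h) y = scal en c * homS_fun h y.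
  by rewrite homS_scaleE rho_scal homS_lamE.
have sumE Y (F : 'I_(dimS en) -> homS en Y) y :
    homS_fun (\sum_q F q) y = \sum_q homS_fun (F q) y.
  exact: (big_morph (fun h : homS en Y => homS_fun h y) (fun _ _ => erefl) erefl).
have l (p : 'I_(dimS en)) : linear (fun x : restr (lam en) (syz X j.+1) =>
    kap p (f (x : syz X j.+1) : E) : S^o).
  move=> a x y; rewrite restr_scaleE linearP kapD; congr (_ + _).
  exact: (kap_lam p a (f x : E)).
pose fc p : homS en (syz X j.+1) := lin_homS (mklin (l p)).
have fcE b p : b *: fc p = \sum_q scal en (cfun p (bas q * b)) *: fc q.
  apply: homS_ext => x; rewrite sumE homS_scaleE.
  rewrite -[LHS]/(kap p (f (rho en b *: x) : E)) linearZ.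
  by rewrite [LHS](kap_rhoM p b (f x : E)); apply: eq_bigr => q _; rewrite scalE.
pose g (y : 'rV[E]_(rk X j)) : E^o :=
  \sum_p lam en (homS_fun (s (fc p)) y) * rho en (bas p).
have lg : linear g.
  apply: (@enveloping_linear k S E en 'rV[E]_(rk X j) E^o g) => [x y|a x|b x].
  - by rewrite /g -big_split; apply: eq_bigr => p _;
      rewrite homS_funD rmorphD mulrDl.
  - rewrite /g scaler_sumr; apply: eq_bigr => p _.
    by rewrite homS_lamE rmorphM -mulrA.
  transitivity (\sum_p \sum_q lam en (homS_fun (s (fc q)) x) *
      (lam en (scal en (cfun p (bas q * b))) * rho en (bas p))).
    apply: eq_bigr => p _; rewrite -homS_scaleE -linearZ fcE linear_sum sumE.
    rewrite rmorph_sum mulr_suml; apply: eq_bigr => q _.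
    have -> : s (scal en (cfun p (bas q * b)) *: fc q) =
        scal en (cfun p (bas q * b)) *: s (fc q) by exact: linearZ_LR.
    by rewrite scalE scalC rmorphM mulrA.
  rewrite exchange_big /g scaler_sumr; apply: eq_bigr => q _ /=.
  rewrite -mulr_sumr -rho_bas_sum rhoM mulrA lam_rho -mulrA.
  by [].
exists (mklin lg) => x; rewrite /= /g [RHS](kap_sum en); apply: eq_bigr => p _.
congr (lam en _ * _).
exact: (congr1 (fun h => homS_fun h x) (sE (fc p))).
Qed.

Lemma injres_ext n :
  ((forall j, (n <= j)%N -> extends (rincl X j) E^o) ->
   forall a, exists2 N, (a <= N)%N & st_retract (syz X n) (syz X (N + n))) ->
  has_injective_resolution S^o n <->
  (forall j, (n <= j)%N -> extends (rincl X j) E^o).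
Proof.
move=> rec; rewrite (injres_regular b0C b0_bij isoX); split=> [iC j|ext].
  exact: cosyz_injective_ext iC.
by apply: ext_cosyz_injective => //; exact: rec.
Qed.

End Transfer.

(** * The enveloping algebra of a finite dimensional algebra *)

Section EnvelopingNoetherian.
Variables (k : fieldType) (S E : pzRingType) (en : enveloping k S E).

Lemma enveloping_span (z : E) : exists c : 'I_(dimS en) * 'I_(dimS en) -> k,
  z = \sum_qp lam en (scal en (c qp)) * (lam en (bas qp.1) * rho en (bas qp.2)).
Proof.
exists (fun qp => cfun qp.1 (kap qp.2 z)).
rewrite -(pair_bigA _ (fun q p => lam en (scal en (cfun q (kap p z))) *
  (lam en (bas q) * rho en (bas p)))) /= exchange_big {1}(kap_sum en z).
apply: eq_bigr => p _; rewrite {1}(bas_sum en (kap p z)) rmorph_sum mulr_suml.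
by apply: eq_bigr => q _; rewrite rmorphM mulrA.
Qed.

Definition env_scal (c : k) : E := lam en (scal en c).

Lemma enveloping_noetherian : noetherian E.
Proof. exact: (@finite_dim_noetherian k E (lam en \o scal en) _ _ enveloping_span). Qed.

Definition env_scalc (c : k) : E^c := env_scal c.

Fact env_scalc_zmod : zmod_morphism env_scalc.
Proof. exact: (rmorphB (lam en \o scal en)). Qed.

Fact env_scalc_monoid : monoid_morphism env_scalc.
Proof.
split; first exact: (rmorph1 (lam en \o scal en)).
by move=> a b; rewrite mulrC; exact: (rmorphM (lam en \o scal en)).
Qed.

HB.instance Definition _ := GRing.isZmodMorphism.Build k E^c env_scalc env_scalc_zmod.
HB.instance Definition _ := GRing.isMonoidMorphism.Build k E^c env_scalc env_scalc_monoid.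

Lemma enveloping_noetherianc : noetherian E^c.
Proof.
apply: (@finite_dim_noetherian k E^c env_scalc _
  (fun qp : 'I_(dimS en) * 'I_(dimS en) => lam en (bas qp.1) * rho en (bas qp.2) : E)).
move=> z; have [c zE] := enveloping_span z; exists c; rewrite [LHS]zE.
apply: eq_bigr => qp _; rewrite [RHS]/GRing.mul /= /env_scalc /env_scal.
by rewrite mulrA -rmorphM scalC rmorphM -!mulrA lam_rho.
Qed.

End EnvelopingNoetherian.

Section Envelope.
Variables (k : fieldType) (A : falgType k).
Local Notation n := (\dim {:A}).
Local Notation crd := (coord (vbasis {:A})).

Definition tensl (a : A) : envelope A := tens a 1.
Definition tensr (b : A^c) : envelope A := tens 1 (b : A).

Lemma tensDl (a b c : A) : tens (a + b) c = tens a c + tens b c.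
Proof. by have := (tens_bilinear A).1 c 1 a b; rewrite !scale1r. Qed.

Lemma tensDr (a b c : A) : tens a (b + c) = tens a b + tens a c.
Proof. by have := (tens_bilinear A).2 a 1 b c; rewrite !scale1r. Qed.

Lemma tensZl x (a b : A) : tens (x *: a) b = x *: tens a b.
Proof.
have := (tens_bilinear A).1 b x a 0; rewrite addr0 => ->.
have := (tens_bilinear A).1 b (-1) 0 0.
by rewrite scaler0 addr0 scaleN1r addNr => ->; rewrite addr0.
Qed.

Lemma tensZr x (a b : A) : tens a (x *: b) = x *: tens a b.
Proof.
have := (tens_bilinear A).2 a x b 0; rewrite addr0 => ->.
have := (tens_bilinear A).2 a (-1) 0 0.
by rewrite scaler0 addr0 scaleN1r addNr => ->; rewrite addr0.
Qed.

Fact tensl_zmod : zmod_morphism tensl.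
Proof. by move=> a b; rewrite /tensl -scaleN1r tensDl tensZl scaleN1r. Qed.

Fact tensl_monoid : monoid_morphism tensl.
Proof. by split=> // a b; rewrite /tensl tensM !mulr1. Qed.

Fact tensr_zmod : zmod_morphism tensr.
Proof. by move=> a b; rewrite /tensr -scaleN1r tensDr tensZr scaleN1r. Qed.

Fact tensr_monoid : monoid_morphism tensr.
Proof. by split=> // a b; rewrite /tensr tensM !mulr1. Qed.

HB.instance Definition _ :=
  GRing.isZmodMorphism.Build A (envelope A) tensl tensl_zmod.
HB.instance Definition _ :=
  GRing.isMonoidMorphism.Build A (envelope A) tensl tensl_monoid.
HB.instance Definition _ :=
  GRing.isZmodMorphism.Build A^c (envelope A) tensr tensr_zmod.
HB.instance Definition _ :=
  GRing.isMonoidMorphism.Build A^c (envelope A) tensr tensr_monoid.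

Definition in_algc (c : k) : A^c := (c%:A : A).

Fact in_algc_zmod : zmod_morphism in_algc.
Proof. by move=> a b; rewrite /in_algc scalerBl. Qed.

Fact in_algc_monoid : monoid_morphism in_algc.
Proof.
split=> [|a b]; first exact: scale1r.
by rewrite mulrC; exact: (rmorphM (GRing.in_alg A)).
Qed.

HB.instance Definition _ := GRing.isZmodMorphism.Build k A^c in_algc in_algc_zmod.
HB.instance Definition _ :=
  GRing.isMonoidMorphism.Build k A^c in_algc in_algc_monoid.

Definition kapl (p : 'I_n) (z : envelope A) : A := \sum_i z i p *: vbase i.
Definition kapr (p : 'I_n) (z : envelope A) : A^c := \sum_i z p i *: vbase i.

Lemma kapl_linear p : linear (kapl p).
Proof.
move=> a y z; rewrite /kapl scaler_sumr -big_split; apply: eq_bigr => i _.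
by rewrite !mxE scalerDl scalerA.
Qed.

Lemma kapr_linear p : linear (kapr p : envelope A -> A).
Proof.
move=> a y z; rewrite /kapr scaler_sumr -big_split; apply: eq_bigr => i _.
by rewrite !mxE scalerDl scalerA.
Qed.

Lemma kapl_tens p a b : kapl p (tens a b) = crd p b *: a.
Proof.
rewrite [in RHS](vbase_sum a) scaler_sumr; apply: eq_bigr => i _.
by rewrite mxE scalerA mulrC.
Qed.

Lemma kapr_tens p a b : kapr p (tens a b) = crd p a *: b.
Proof.
rewrite [in RHS](vbase_sum b) scaler_sumr; apply: eq_bigr => i _.
by rewrite mxE scalerA.
Qed.

Definition enveloping_left : enveloping k A (envelope A).
Proof.
refine (@Enveloping k A (envelope A) (GRing.in_alg A) tensl (tens 1) n
  (@vbase k A) crd kapl _ _ _ _ _ _ _ _ _ _ _).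
- by move=> c s; rewrite /= mulr_algl mulr_algr.
- by move=> s; rewrite {1}(vbase_sum s); apply: eq_bigr => p _; rewrite mulr_algl.
- by move=> a b; rewrite tensDr.
- by [].
- by move=> a b; rewrite tensM mulr1.
- by move=> a b; rewrite !tensM !mulr1 !mul1r.
- by move=> c; rewrite /= /tensl tensZl tensZr.
- move=> z; rewrite {1}(env_sum z) exchange_big; apply: eq_bigr => p _ /=.
  rewrite tensM mulr1 mulr1 /kapl.
  rewrite (linear_comb _ _ _ ((tens_bilinear A).1 _)).
  by [].
- by move=> p y z; have := kapl_linear p 1 y z; rewrite !scale1r.
- move=> p a; apply: env_ind => [c y z|c y z|c d].
  + by rewrite [tensl a * _]env_mul_linearr kapl_linear.
  + by rewrite kapl_linear mulrDr scalerAr.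
  + by rewrite tensM mulr1 !kapl_tens scalerAr.
- by move=> p b; rewrite kapl_tens.
Defined.

Definition enveloping_right : enveloping k A^c (envelope A).
Proof.
refine (@Enveloping k A^c (envelope A) in_algc tensr (fun a => tens (a : A) 1) n
  (@vbase k A) (fun p (s : A^c) => crd p (s : A)) kapr _ _ _ _ _ _ _ _ _ _ _).
- by move=> c s; rewrite /GRing.mul /= /in_algc mulr_algl mulr_algr.
- move=> s; rewrite {1}(vbase_sum (s : A)); apply: eq_bigr => p _.
  by rewrite [RHS]/GRing.mul /= /in_algc mulr_algr.
- by move=> a b; rewrite tensDl.
- by [].
- by move=> a b; rewrite tensM mulr1.
- by move=> a b; rewrite /= /tensr !tensM !mulr1 !mul1r.
- by move=> c; rewrite /= /tensr /in_algc tensZl tensZr.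
- move=> z; rewrite {1}(env_sum z); apply: eq_bigr => p _ /=.
  rewrite /tensr tensM mul1r mul1r /kapr.
  rewrite (linear_comb _ _ _ ((tens_bilinear A).2 _)).
  by [].
- by move=> p y z; have := kapr_linear p 1 y z; rewrite !scale1r.
- move=> p a; apply: (@env_ind _ _ A) => [c y z|c y z|c d].
  + by rewrite [tensr a * _]env_mul_linearr kapr_linear.
  + by rewrite kapr_linear [LHS]/GRing.mul /= mulrDl scalerAl.
  + by rewrite /= /tensr tensM mul1r !kapr_tens [RHS]/GRing.mul /= scalerAl.
- by move=> p b; rewrite kapr_tens.
Defined.

Lemma regular_fin_gen : fin_gen (regular_bimodule A).
Proof.
exists 1, (fun=> 1 : A) => x; exists (fun=> tens (x : A) 1).
by rewrite big_ord1 tens_scale !mulr1.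
Qed.

End Envelope.

Theorem theorem5p7 (k : fieldType) (A : falgType k)
    (A_evper : eventually_periodic_algebra A) :
  (Gorenstein A <-> Gdim (regular_bimodule A) != None) /\
  (Gorenstein A -> Gdim (regular_bimodule A) = inj_dim (A^o : lmodType A)).
Proof.
have noe := enveloping_noetherian (enveloping_left A).
have noec := enveloping_noetherianc (enveloping_left A).
have [X isoX] := resolution_exists noe (regular_fin_gen A).
have [m [p [p0 r]]] := eventually_periodic_res isoX A_evper.
have rec n := syz_recurrent (n := n) p0 r.
pose ext n := forall j, (n <= j)%N -> extends (rincl X j) (envelope A)^o.
have G n : has_Gresolution (regular_bimodule A) n <-> ext n.
  split=> [Gn j nj|en].
    have := extv_res_st_retract (Gres_extv Gn nj) (st_retract_iso isoX).
    by rewrite addn0.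
  apply: Gres_iso isoX _; apply: Gres_of_syz => //; rewrite addn0.
  exact: (syz_totally_reflexive noe noec en (rec _ en)).
have L n : has_injective_resolution (A^o : lmodType A) n <-> ext n.
  refine (@injres_ext k A _ (enveloping_left A) (regular_bimodule A) (1 : A)
    _ _ X isoX n (rec n)).
    by move=> s; rewrite /= !tens_scale !mulr1 mul1r.
  by exists id => s; rewrite /= tens_scale !mulr1.
have Rr n : has_injective_resolution ((A^c)^o : lmodType A^c) n <-> ext n.
  refine (@injres_ext k A^c _ (enveloping_right A) (regular_bimodule A) (1 : A)
    _ _ X isoX n (rec n)).
    by move=> s; rewrite /= !tens_scale !mulr1 mul1r.
  by exists id => s; rewrite /= tens_scale !mul1r.
have GL : Gdim (regular_bimodule A) = inj_dim (A^o : lmodType A).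
  by congr inf_nat; apply/funext => n; apply/propext; rewrite G L.
have GR : Gdim (regular_bimodule A) = inj_dim ((A^c)^o : lmodType A^c).
  by congr inf_nat; apply/funext => n; apply/propext; rewrite G Rr.
by rewrite /Gorenstein -GL -GR; split=> //; split=> [[]|].
Qed.
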